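(* In the setting described in the context, for every $x\in\mathcal X$ the Clarke subdifferential of the reduced hyperobjective $\tilde\varphi(u)=\varphi(u,y(u))$ at $x$ is $$\partial^c\tilde\varphi(x)=\{\,d_x(x)+V^\top d_y(x)\;:\;V\in \mathrm J^c y(x)\,\}.$$
   Context: Norms: Euclidean for vectors, the induced operator (spectral) norm for matrices. $\mathbb B_n$ is the closed unit ball of $\mathbb R^n$. Response mapping. $\mathcal X\subset\mathbb R^n$ is nonempty and compact. $\mathcal N$ is an open set containing $\mathcal X$. For each $x\in\mathcal N$ the lower-level solution set $S(x)=\arg\min_{\xi\in\mathcal Y}g(x,\xi)$ (with $\mathcal Y\subseteq\mathbb R^m$) is a singleton $\{y(x)\}$, and the response map $y:\mathcal N\to\mathbb R^m$ is locally Lipschitz. A number $\bar\delta>0$ with $\mathcal X_{\bar\delta}:=\mathcal X+\bar\delta\mathbb B_n\subseteq\mathcal N$ is fixed; on $\mathcal X_{\bar\delta}$, $y$ is bounded in norm by $Y_{\max}$ and $L_y$-Lipschitz. Upper-level objective. $\varphi\in C^1(\mathbb R^n\times\mathbb R^m)$ with partial gradients $\nabla_1\varphi$ (in $x$) and $\nabla_2\varphi$ (in $y$). There are finite constants $L_{1x},L_{1y},L_{2x},L_{2y},M_y>0$ such that for all $(x,y),(x',y')\in W$: $\|\nabla_1\varphi(x,y)-\nabla_1\varphi(x',y')\|\le L_{1x}\|x-x'\|+L_{1y}\|y-y'\|$, $\|\nabla_2\varphi(x,y)-\nabla_2\varphi(x',y')\|\le L_{2x}\|x-x'\|+L_{2y}\|y-y'\|$,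 $\|\nabla_2\varphi(x,y)\|\le M_y$. Here $W\subseteq\mathbb R^n\times\mathbb R^m$ is a set containing all pairs $(x,y(x))$ and $(x,y_\delta(x))$ with $x\in\mathcal X$, $0<\delta\le\bar\delta$, where $y_\delta(x)=\mathbb E_{\xi\sim\mathrm{Unif}(\mathbb B_n)}[y(x+\delta\xi)]$. Reduced hyperobjective: $\tilde\varphi(x)=\varphi(x,y(x))$ on $\mathcal N$. Notation: $d_x(x)=\nabla_1\varphi(x,y(x))$, $d_y(x)=\nabla_2\varphi(x,y(x))$. Clarke objects. For a locally Lipschitz map $F:\mathcal O\to\mathbb R^m$ on an open set $\mathcal O\subseteq\mathbb R^n$, differentiable exactly on the full-measure set $\Omega_F$, the Clarke generalized Jacobian is $\mathrm J^cF(x)=\operatorname{conv}\{\lim_k \mathrm JF(x^k): x^k\to x,\ x^k\in\Omega_F\}$ (over sequences for which the limit exists), where $\mathrm JF\in\mathbb R^{m\times n}$ is the Jacobian. For scalar $f$, $\partial^cf(x)=\operatorname{conv}\{\lim_k\nabla f(x^k):x^k\to x,\ x^k\in\Omega_f\}$. *)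

(* Defs.v *)
From HB Require Import structures.
From mathcomp Require Import all_boot all_order all_algebra.
From mathcomp Require Import all_classical all_reals all_analysis.

Set Implicit Arguments.
Unset Strict Implicit.
Unset Printing Implicit Defensive.

Import Order.TTheory GRing.Theory Num.Theory.
Import numFieldNormedType.Exports.

Local Open Scope classical_set_scope.
Local Open Scope ring_scope.

(* Vectors of R^n are rows 'rV[R]_n.  The library norm on 'rV[R]_n is the sup
   norm; it is used only through the topology, the notion of differentiability
   and the limits it induces, which are those of the Euclidean norm.  Every
   quantitative estimate uses [enorm]. *)

Definition enorm (R : realType) (n : nat) (v : 'rV[R]_n) : R :=
  Num.sqrt (\sum_(i < n) v ord0 i ^+ 2).

Definition unit_ball (R : realType) (n : nat) : set 'rV[R]_n :=
  [set v | enorm v <= 1].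

Arguments unit_ball {R n}.

Definition locally_lipschitz_on (R : realType) (n m : nat)
    (A : set 'rV[R]_n) (f : 'rV[R]_n -> 'rV[R]_m) : Prop :=
  forall x, A x -> exists L : R, exists2 U, nbhs x U &
    forall u v, U u -> U v -> enorm (f u - f v) <= L * enorm (u - v).

Definition argmin (R : realType) (T : Type) (A : set T) (f : T -> R) : set T :=
  [set t | A t /\ forall s, A s -> f t <= f s].

(* n-dimensional Lebesgue measure, on n-tuples with their product sigma-algebra:
   the point mass for n = 0, then the image of lambda_1 \x lambda_n under
   (t, s) |-> t :: s. *)

Section cons_measure.
Context (d : measure_display) (T : measurableType d) (R : realType) (n : nat).

Definition tuple_cons (p : T * n.-tuple T) : n.+1.-tuple T :=
  [the n.+1.-tuple T of p.1 :: p.2].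

Lemma measurable_tuple_cons : measurable_fun setT tuple_cons.
Proof. exact: measurable_cons. Qed.

Variables (mu1 : {sigma_finite_measure set T -> \bar R})
          (mu : {sigma_finite_measure set (n.-tuple T) -> \bar R}).

Definition cons_measure : set (n.+1.-tuple T) -> \bar R :=
  pushforward (mu1 \x mu)%E tuple_cons.

Let cons_measure0 : cons_measure set0 = 0%E.
Proof. by rewrite /cons_measure /pushforward preimage_set0 measure0. Qed.

Let cons_measure_ge0 A : (0 <= cons_measure A)%E.
Proof. by rewrite /cons_measure /pushforward measure_ge0. Qed.

Let measurable_preimage_tuple_cons (A : set (n.+1.-tuple T)) :
  measurable A -> measurable (tuple_cons @^-1` A).
Proof.
by move=> mA; rewrite -[X in measurable X]setTI; exact: measurable_tuple_cons.
Qed.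

Let cons_measure_sigma_additive : semi_sigma_additive cons_measure.
Proof.
move=> F mF tF mUF; rewrite /cons_measure /pushforward preimage_bigcup.
apply: measure_semi_sigma_additive.
- by move=> k; exact: measurable_preimage_tuple_cons.
- apply/trivIsetP => /= i j _ _ ij; rewrite -preimage_setI.
  by move/trivIsetP : tF => /(_ _ _ _ _ ij) ->//; rewrite preimage_set0.
- by rewrite -preimage_bigcup; exact: measurable_preimage_tuple_cons.
Qed.

HB.instance Definition _ := isMeasure.Build _ _ _ cons_measure
  cons_measure0 cons_measure_ge0 cons_measure_sigma_additive.

Lemma sigma_finite_cons_measure : sigma_finite setT cons_measure.
Proof.
have /sigma_finiteP[F [TF ndF Foo]] := sigma_finiteT mu1.
have /sigma_finiteP[G [TG ndG Goo]] := sigma_finiteT mu.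
pose un (t : n.+1.-tuple T) : T * n.-tuple T := (thead t, [tuple of behead t]).
have mun : measurable_fun setT un.
  apply: measurable_fun_pair; first exact: measurable_tnth.
  exact: measurable_behead.
have consK : cancel tuple_cons un.
  by case=> x t; congr pair => //; exact/val_inj.
exists (fun k => un @^-1` (F k `*` G k)).
  rewrite -preimage_bigcup; apply/esym/seteqP; split=> // t _ /=.
  have [i _ Fi] : (\bigcup_i F i) (thead t) by rewrite -TF.
  have [j _ Gj] : (\bigcup_i G i) [tuple of behead t] by rewrite -TG.
  exists (maxn i j) => //; split=> /=.
  - by move: Fi; exact/subsetPset/ndF/leq_maxl.
  - by move: Gj; exact/subsetPset/ndG/leq_maxr.
move=> k; have [mF Fk] := Foo k; have [mG Gk] := Goo k; split.
  by rewrite -[X in measurable X]setTI; apply: mun => //; exact: measurableX.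
rewrite /cons_measure /pushforward -comp_preimage.
rewrite (_ : un \o _ = id) ?preimage_id; last first.
  by apply/funext => p; exact: consK.
by rewrite product_measure1E// lte_mul_pinfty// ge0_fin_numE.
Qed.

HB.instance Definition _ := Measure_isSigmaFinite.Build _ _ R cons_measure
  sigma_finite_cons_measure.

End cons_measure.

Fixpoint lebesgue_tuple (R : realType) (n : nat) :
    {sigma_finite_measure set (n.-tuple (measurableTypeR R)) -> \bar R} :=
  match n with
  | 0 => dirac [tuple]
  | k.+1 => cons_measure (@lebesgue_measure R) (lebesgue_tuple R k)
  end.

Definition row_of_tuple (R : realType) (n : nat)
    (t : n.-tuple (measurableTypeR R)) : 'rV[R]_n := \row_i tnth t i.

(* E[f(xi)] for xi uniform on the closed Euclidean unit ball of R^n. *)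
Definition expect_unif_ball (R : realType) (n : nat) (f : 'rV[R]_n -> R) : R :=
  let B := @row_of_tuple R n @^-1` unit_ball in
  (\int[lebesgue_tuple R n]_(t in B) f (row_of_tuple t)) /
  fine (lebesgue_tuple R n B).

Definition smoothed (R : realType) (n m : nat) (y : 'rV[R]_n -> 'rV[R]_m)
    (delta : R) (x : 'rV[R]_n) : 'rV[R]_m :=
  \row_j expect_unif_ball (fun xi => y (x + delta *: xi) ord0 j).

Definition grad (R : realType) (n : nat) (f : 'rV[R]_n -> R) (x : 'rV[R]_n) :
    'rV[R]_n := \row_i 'd f x (delta_mx ord0 i).

Definition grad1 (R : realType) (n m : nat) (f : 'rV[R]_n * 'rV[R]_m -> R)
    (x : 'rV[R]_n) (y : 'rV[R]_m) : 'rV[R]_n := grad (fun u => f (u, y)) x.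

Definition grad2 (R : realType) (n m : nat) (f : 'rV[R]_n * 'rV[R]_m -> R)
    (x : 'rV[R]_n) (y : 'rV[R]_m) : 'rV[R]_m := grad (fun v => f (x, v)) y.

Definition C1 (R : realType) (n m : nat) (f : 'rV[R]_n * 'rV[R]_m -> R) : Prop :=
  [/\ forall z, differentiable f z,
      continuous (fun z => grad1 f z.1 z.2) &
      continuous (fun z => grad2 f z.1 z.2)].

(* The library's 'J F x acts on rows from the right, so it is n x m; the usual
   m x n Jacobian is its transpose. *)
Definition jac (R : realType) (n m : nat) (F : 'rV[R]_n -> 'rV[R]_m)
    (x : 'rV[R]_n) : 'M[R]_(m, n) := ('J F x)^T.

Definition convex_hull (R : realType) (E : lmodType R) (A : set E) : set E :=
  smallest (@convex_set R E) A.

(* Only the values of F on the open set O matter. *)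
Definition clarke_jacobian (R : realType) (n m : nat) (O : set 'rV[R]_n)
    (F : 'rV[R]_n -> 'rV[R]_m) (x : 'rV[R]_n) : set 'M[R]_(m, n) :=
  convex_hull [set V : 'M[R]_(m, n) | exists u : nat -> 'rV[R]_n,
    [/\ forall k, O (u k) /\ differentiable F (u k),
        u @ \oo --> x &
        (fun k => jac F (u k)) @ \oo --> V]].

Definition clarke_subdifferential (R : realType) (n : nat) (O : set 'rV[R]_n)
    (f : 'rV[R]_n -> R) (x : 'rV[R]_n) : set 'rV[R]_n :=
  convex_hull [set v : 'rV[R]_n | exists u : nat -> 'rV[R]_n,
    [/\ forall k, O (u k) /\ differentiable f (u k),
        u @ \oo --> x &
        (fun k => grad f (u k)) @ \oo --> v]].

(* Main.v *)
(* At a point of differentiability of y the chain rule reads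
   grad f (u) = d_x(u) + d_y(u) Jy(u), and limits of Jacobians give limits of
   gradients; since the affine map V |-> d_x + d_y V preserves convexity, this is
   the inclusion from right to left.

   The converse must deal with points where f is differentiable and y is not.
   Let b be a limit of gradients of f and d a direction.  Near x, phi is strictly
   differentiable, so <b, d> is up to e the difference quotient of
   <y, d_y> along d, plus <d_x, d>.  By Rademacher's theorem and Fubini, almost
   every parallel segment meets the non-differentiability set of y in a null set,
   whence a mean value inequality: this quotient is at most <d_y Jy(v), d> + e for
   some v near x where y is differentiable.  Compactness of the set J of limit
   Jacobians yields V in J with <b, d> <= <d_x + d_y V, d>.  As d is arbitrary and
   the hull of the compact set d_x + d_y J is compact (Caratheodory), b lies in
   it by separation.

   Rademacher's theorem: the difference quotients along an integer vector
   converge almost everywhere by the one-dimensional case and Fubini; their limit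
   is almost everywhere additive in the vector because the additivity defect has
   zero L2 norm, by discrete integration by parts; rounding a small increment h to
   an integer multiple of 1/k with k of order 1/|h| gives differentiability. *)

Require Import Defs.
From HB Require Import structures.
From mathcomp Require Import all_boot all_order all_algebra.
From mathcomp Require Import all_classical all_reals all_analysis.
From mathcomp Require Import measurable_realfun zify ring lra.

Set Implicit Arguments.
Unset Strict Implicit.
Unset Printing Implicit Defensive.

Import Order.TTheory GRing.Theory Num.Theory.
Import numFieldNormedType.Exports.

Local Open Scope classical_set_scope.
Local Open Scope ring_scope.

(** * Lebesgue measure on tuples: translations, cubes, open sets, and Fubini along parallel
    segments *)

Section tuple_measure.
Context {R : realType}.
Local Notation T n := (n.-tuple (measurableTypeR R)).
Local Notation lambda := (@lebesgue_measure R).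

Definition translate n (a : 'rV[R]_n) (t : T n) : T n :=
  [tuple tnth t i + a ord0 i | i < n].

Lemma row_of_translate n a (t : T n) :
  row_of_tuple (translate a t) = row_of_tuple t + a.
Proof. by apply/rowP => i; rewrite !mxE tnth_mktuple. Qed.

Lemma measurable_translate2 n (v : 'rV[R]_n) :
  measurable_fun setT
    (fun z : measurableTypeR R * T n => translate (z.1 *: v) z.2).
Proof.
apply/measurable_fun_tnthP => i.
rewrite (_ : _ \o _ = fun z => tnth z.2 i + z.1 * v ord0 i :> R); last first.
  by apply/funext => z /=; rewrite tnth_mktuple mxE.
apply: measurable_funD.
  by apply: (measurableT_comp (measurable_tnth i)).
by apply: measurable_funM.
Qed.

Lemma measurable_translate n (v : 'rV[R]_n) : measurable_fun setT (translate v).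
Proof.
apply/measurable_fun_tnthP => i.
rewrite (_ : _ \o _ = fun t => tnth t i + v ord0 i :> R); last first.
  by apply/funext => z /=; rewrite tnth_mktuple.
apply: measurable_funD => //.
exact: measurable_tnth.
Qed.

(** Lebesgue measure is determined by the lengths of half-open intervals, and a shift preserves
    these. *)
Lemma lebesgue_measure_translate (a : R) (A : set (measurableTypeR R)) :
  measurable A -> lambda ((fun x => x + a) @^-1` A) = lambda A.
Proof.
move=> mA; apply/esym.
apply: (@lebesgue_measure_unique R (pushforward lambda
  ((fun x => x + a) : _ -> measurableTypeR R))) => //=.
  exact: measurable_funD.
move=> _ X [[x y] _ <-] /=.
rewrite /pushforward (_ : _ @^-1` _ = `](x - a), (y - a)]%classic); last first.
  by apply/seteqP; split=> z /=; rewrite !in_itv/= ltrBlDr lerBrDr.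
rewrite !lebesgue_measure_itv/= !lte_fin ltrD2r; case: ifP => // _.
by rewrite -!EFinD; congr (_%:E); ring.
Qed.

Lemma translate_cons n (a : 'rV[R]_n.+1) s (t : T n) :
  translate a (tuple_cons (s, t)) =
  tuple_cons (s + a ord0 ord0, translate (\row_i a ord0 (lift ord0 i)) t).
Proof.
apply: eq_from_tnth => i; rewrite tnth_mktuple.
case: (unliftP ord0 i) => [j|] ->; last by rewrite !tnth0.
by rewrite !tnthS tnth_mktuple mxE.
Qed.

(** Induction on [n]: the translated product measure agrees with the original one on rectangles, and
    uniqueness of the product measure does the rest. *)
Lemma lebesgue_tuple_translate n (a : 'rV[R]_n) (A : set (T n)) :
  measurable A ->
  lebesgue_tuple R n (translate a @^-1` A) = lebesgue_tuple R n A.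
Proof.
elim: n a A => [|n IH] a A mA.
  congr (lebesgue_tuple R 0 _); apply/seteqP; split=> t;
  by rewrite /preimage/= (tuple0 (translate a t)) (tuple0 t).
rewrite /= /cons_measure /pushforward.
set a' : 'rV_n := \row_i a ord0 (lift ord0 i).
pose sg (z : measurableTypeR R * T n) : measurableTypeR R * T n :=
  (z.1 + a ord0 ord0, translate a' z.2).
have msg : measurable_fun setT sg.
  apply: measurable_fun_pair.
    by apply: measurable_funD.
  by apply: measurableT_comp => //; exact: measurable_translate.
have mA' : measurable (@tuple_cons _ (measurableTypeR R) n @^-1` A).
  by rewrite -[X in measurable X]setTI; exact: measurable_tuple_cons.
rewrite (_ : _ @^-1` (_ @^-1` A) = sg @^-1` (@tuple_cons _ (measurableTypeR R) n @^-1` A)); last first.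
  by apply/seteqP; split=> -[s t]; rewrite /preimage/= translate_cons.
apply/esym.
apply: (product_measure_unique (m' := pushforward (lambda \x lebesgue_tuple R n)%E sg)) => //.
move=> B C mB mC; rewrite /pushforward.
transitivity ((lambda \x lebesgue_tuple R n)%E
   (((fun x => x + a ord0 ord0) @^-1` B) `*` (translate a' @^-1` C))).
  by [].
rewrite product_measure1E//.
- by rewrite IH//; congr (_ * _)%E; exact: lebesgue_measure_translate.
- rewrite -[X in measurable X]setTI.
  have : measurable_fun [set: measurableTypeR R]
    ((fun x => x + a ord0 ord0) : _ -> measurableTypeR R) by exact: measurable_funD.
  exact.
- by rewrite -[X in measurable X]setTI; exact: measurable_translate.
Qed.

Lemma preimage_row_of_tuple_ball n (c : 'rV[R]_n) r : 0 < r ->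
  @row_of_tuple R n @^-1` ball c r =
  \bigcap_(i : 'I_n) (@tnth n (measurableTypeR R) ^~ i @^-1` ball (c ord0 i) r).
Proof.
move=> r0; apply/seteqP; split=> t /=.
  by move=> [_ ct] i _; have := ct ord0 i; rewrite mxE.
by move=> ct; split=> // i j; rewrite ord1 mxE; exact: ct.
Qed.

Lemma measurable_row_of_tuple_ball n (c : 'rV[R]_n) r : 0 < r ->
  measurable (@row_of_tuple R n @^-1` ball c r).
Proof.
move=> r0; rewrite preimage_row_of_tuple_ball//.
apply: fin_bigcap_measurable => // i _.
rewrite -[X in measurable X]setTI; apply: measurable_tnth => //.
exact: measurable_ball.
Qed.

(** Balls of the sup norm are cubes of side [2r]. Finiteness of the value serves integrability,
    positivity serves the density of sets of full measure. *)
Lemma lebesgue_tuple_ball n (c : 'rV[R]_n) r : 0 < r ->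
  lebesgue_tuple R n (@row_of_tuple R n @^-1` ball c r) = ((r *+ 2) ^+ n)%:E.
Proof.
move=> r0; elim: n c => [|n IH] c.
  rewrite expr0/= diracE mem_set//; split=> // i; by case.
rewrite /= /cons_measure /pushforward.
pose c' : 'rV_n := \row_i c ord0 (lift ord0 i).
rewrite (_ : _ @^-1` _ =
    ball (c ord0 ord0) r `*` (@row_of_tuple R n @^-1` ball c' r)); last first.
  rewrite !preimage_row_of_tuple_ball//; apply/seteqP; split=> -[s t] /=.
    move=> h; split=> [|i _]; first by have := h ord0 Logic.I; rewrite /= tnth0.
    by have := h (lift ord0 i) Logic.I; rewrite /= tnthS mxE.
  move=> [h0 h] i _; case: (unliftP ord0 i) => [j|] -> /=.
    by rewrite tnthS; have := h j Logic.I; rewrite mxE.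
  by rewrite tnth0.
rewrite product_measure1E//; last 2 first.
- exact: measurable_ball.
- exact: measurable_row_of_tuple_ball.
rewrite IH exprS EFinM; congr (_ * _)%E.
by apply: lebesgue_measure_ball; exact: ltW.
Qed.

(** The sigma-algebra is the product one, so an open set is exhibited as a countable union of cubes
    with rational centres and radii [1/(k+1)]. *)
Lemma measurable_row_of_tuple_open n (U : set 'rV[R]_n) : open U ->
  measurable (@row_of_tuple R n @^-1` U).
Proof.
move=> oU.
pose B (p : 'rV[rat]_n * nat) : set 'rV[R]_n :=
  ball (map_mx ratr p.1 : 'rV[R]_n) p.2.+1%:R^-1.
rewrite (_ : _ @^-1` _ = \bigcup_(p in [set: 'rV[rat]_n * nat])
   (@row_of_tuple R n @^-1` [set u | B p `<=` U /\ B p u])).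
  apply: countable_bigcupT_measurable => // p.
  have [BU|BU] := pselect (B p `<=` U).
    rewrite (_ : [set u | _] = B p); last by apply/seteqP; split=> u // [].
    exact: measurable_row_of_tuple_ball.
  rewrite (_ : [set u | _] = set0); last by apply/seteqP; split=> u // [].
  by rewrite preimage_set0.
apply/seteqP; split=> [t Ut|t [p _] [BU Bt]]; last exact: BU.
have /nbhs_ballP[e/= e0 eU] : nbhs (row_of_tuple t) U by exact: open_nbhs_nbhs.
have [k] : exists k, k.+1%:R^-1 < e / 2.
  have e20 : 0 < e / 2 by rewrite divr_gt0.
  have [N _ /(_ N)/(_ (leqnn _))] := near_infty_natSinv_lt (PosNum e20).
  by exists N.
move=> ke.
have k0 : 0 < k.+1%:R^-1 :> R by rewrite invr_gt0.
(* A rational centre within [1/(k+1) < e/2] of the point: by the triangle inequality its cube stays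
   within distance [e] of the point. *)
have q i : {q : rat | ball (tnth t i : R) k.+1%:R^-1 (ratr q : R)}.
  apply/cid.
  have /rat_in_itvoo[q] : tnth t i - k.+1%:R^-1 < tnth t i + k.+1%:R^-1 :> R.
    by rewrite ltrD2l gtrN.
  by exists q; rewrite ball_itv.
exists (\row_i sval (q i), k) => //.
have Bt : B (\row_i sval (q i), k) (row_of_tuple t).
  apply: ball_sym; split=> // i j; rewrite ord1 !mxE; exact: svalP (q j).
split=> // u Bu; apply: eU; rewrite [e]splitr.
have le_ke : k.+1%:R^-1 <= e / 2 by exact: ltW.
apply: (@ball_triangle _ _ (map_mx ratr (\row_i sval (q i)) : 'rV[R]_n)).
  exact: le_ball le_ke _ (ball_sym Bt).
exact: le_ball le_ke _ Bu.
Qed.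

Lemma continuous_measurable_tuple n (f : 'rV[R]_n -> R) : continuous f ->
  measurable_fun setT (f \o @row_of_tuple R n).
Proof.
move=> cf; apply: (measurability _ (RGenInftyO.measurableE R)) => //.
move=> /= _ [_ [a ->] <-]; rewrite setTI comp_preimage.
apply: measurable_row_of_tuple_open.
by move/continuousP : cf; apply; exact: open_lt.
Qed.

Let lines n (v : 'rV[R]_n) (A : set (T n)) : set (measurableTypeR R * T n) :=
  [set z | `]0, 1[%classic z.1 /\ A (translate (z.1 *: v) z.2)].

Let measurable_lines n v (A : set (T n)) : measurable A ->
  measurable (lines v A).
Proof.
move=> mA; rewrite (_ : lines v A = (`]0, 1[%classic `*` setT) `&`
    (fun z : measurableTypeR R * T n => translate (z.1 *: v) z.2) @^-1` A).
  apply: measurableI; first by apply: measurableX => //; exact: measurable_itv.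
  by rewrite -[X in measurable X]setTI; exact: measurable_translate2.
by apply/seteqP; split=> -[s t] /= [? ?]; split=> //; tauto.
Qed.

Let ysection_lines n v (A : set (T n)) t :
  ysection (lines v A) t = `]0, 1[ `&` [set s | A (translate (s *: v) t)].
Proof.
by apply/seteqP; split=> s /=; rewrite /ysection/= inE.
Qed.

(** Tonelli for [lines v A]: each slice at fixed [s] is a translate of [A], of the same measure, and
    [s] runs over an interval of length 1. *)
Let measure_lines n v (A : set (T n)) : measurable A ->
  (\int[lebesgue_tuple R n]_t
    lambda (`]0%R, 1%R[ `&` [set s | A (translate (s *: v) t)]) =
  lebesgue_tuple R n A)%E.
Proof.
move=> mA; have mL := measurable_lines v mA.
transitivity ((lambda \x lebesgue_tuple R n)%E (lines v A)).
  transitivity ((lambda \x^ lebesgue_tuple R n)%E (lines v A)).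
    rewrite /product_measure2; apply: eq_integral => t _.
    by rewrite /= ysection_lines.
  apply/esym.
  apply: (product_measure_unique
    (m' := (lambda \x^ lebesgue_tuple R n)%E)) => // B C mB mC.
  exact: product_measure2E.
rewrite /product_measure1.
transitivity (\int[lambda]_(s in `]0%R, 1%R[) lebesgue_tuple R n A)%E.
  rewrite [RHS]integral_mkcond; apply: eq_integral => s _ /=.
  rewrite patchE; case: ifPn => [|]; rewrite ?inE ?notin_setE => sI.
    rewrite -(lebesgue_tuple_translate (s *: v) mA); congr (lebesgue_tuple R n _).
    by apply/seteqP; split=> t; rewrite /xsection/= inE => //= -[].
  rewrite -[RHS](measure0 (lebesgue_tuple R n)); congr (lebesgue_tuple R n _).
  by apply/seteqP; split=> t; rewrite /xsection/= inE => //= -[].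
rewrite integral_cst//; have l1 : lambda `]0, 1[%classic = 1%E.
  by rewrite lebesgue_measure_itv/= lte_fin ltr01 sube0.
by transitivity (lebesgue_tuple R n A * 1)%E; [congr (_ * _)%E|rewrite mule1].
Qed.

(** The slice measures integrate to the measure of [A]. This carries one-dimensional
    almost-everywhere statements to the whole space. *)
Lemma null_lines n (A : set (T n)) (v : 'rV[R]_n) : measurable A ->
  (forall t, lambda.-negligible
    (`]0, 1[ `&` [set s | A (translate (s *: v) t)])) ->
  lebesgue_tuple R n A = 0%E.
Proof.
move=> mA A0; rewrite -(measure_lines v mA).
transitivity (\int[lebesgue_tuple R n]_(t in setT) 0)%E; last by rewrite integral0.
apply: eq_integral => t _; apply/negligibleP; last exact: A0.
by rewrite -ysection_lines; apply: measurable_ysection; exact: measurable_lines.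
Qed.

(** The opposite direction: a nonnegative function with zero integral vanishes almost everywhere. It
    supplies segments that a null set meets only in a null set of parameters. *)
Lemma null_ae_lines n (A : set (T n)) (v : 'rV[R]_n) : measurable A ->
  lebesgue_tuple R n A = 0%E ->
  {ae lebesgue_tuple R n, forall t, lambda.-negligible
    (`]0, 1[ `&` [set s | A (translate (s *: v) t)])}.
Proof.
move=> mA A0; have mL := measurable_lines v mA.
have mf : measurable_fun setT (fun t =>
    lambda (`]0%R, 1%R[ `&` [set s | A (translate (s *: v) t)])).
  rewrite (_ : (fun _ => _) = lambda \o ysection (lines v A)).
    exact: measurable_fun_ysection.
  by apply/funext => t /=; rewrite ysection_lines.
have /(ae_eq_integral_abs (lebesgue_tuple R n) measurableT mf) :
    (\int[lebesgue_tuple R n]_t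
     `|lambda (`]0%R, 1%R[ `&` [set s | A (translate (s *: v) t)])| = 0)%E.
  rewrite -[RHS]A0 -(measure_lines v mA); apply: eq_integral => t _.
  by rewrite gee0_abs.
apply: filterS => t /(_ Logic.I) At0; apply/negligibleP => //.
by rewrite -ysection_lines; exact: measurable_ysection.
Qed.

End tuple_measure.

(** * Lipschitz functions of one variable: derivatives almost everywhere, and increments recovered
    from them *)

Lemma lipschitz_continuous {R : realType} {V W : normedModType R} (f : V -> W)
    (L : R) : 0 < L -> (forall u v, `|f u - f v| <= L * `|u - v|) ->
  continuous f.
Proof.
move=> L0 fL x; apply/cvgrPdist_le => e e0; near=> y.
rewrite (le_trans (fL _ _))// mulrC -ler_pdivlMr//.
by near: y; apply: cvgr_dist_le; [exact: cvg_id|exact: divr_gt0].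
Unshelve. all: by end_near. Qed.

(** The increments are [1/(k+1)] only: limits then run over a sequence, and measurability and
    dominated convergence apply. *)
Definition diffquo {R : realType} {V : lmodType R} (f : V -> R) (v x : V) :
  R^nat := fun k => k.+1%:R * (f (x + k.+1%:R^-1 *: v) - f x).

Section lipschitz1.
Context {R : realType}.
Local Notation lambda := (@lebesgue_measure R).
Variables (h : R -> R) (L : R).
Hypothesis L_gt0 : 0 < L.
Hypothesis hL : forall s t, `|h s - h t| <= L * `|s - t|.

Let F (s : R) : R := h s + L * s.

Let F_nd : {homo F : s t / s <= t}.
Proof.
move=> s t st; have := hL s t.
rewrite /F ler_norml distrC ger0_norm ?subr_ge0// => /andP[]; lra.
Qed.

Let F_continuous : continuous F.
Proof.
move=> s; apply: cvgD; first exact: (lipschitz_continuous (W := R^o) L_gt0 hL).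
by apply: cvgM; [exact: cvg_cst|exact: cvg_id].
Qed.

HB.instance Definition _ := isCumulative.Build R _ R F F_nd
  (right_continuousW F_continuous).

Let mu := lebesgue_stieltjes_measure F.

(* h + L id is nondecreasing and 2L-Lipschitz, so its Stieltjes measure is
   absolutely continuous; its density gives the derivative almost everywhere. *)
Let mu_le A : ((L *+ 2)^-1%:E * mu A <= lambda A)%E.
Proof.
have L20 : 0 < L *+ 2 by rewrite mulrn_wgt0.
apply: le_ereal_inf_tmp => x [B [mB AB] <-].
have le0 (f : cumulative R R) (k : nat) : (0 <= wlength f (B k))%E by have := wlength_ge0 f (B k).
rewrite lee_pdivrMl// -nneseriesZl//.
  apply: (@le_trans _ _ (\sum_(0 <= k <oo) wlength F (B k))%E).
    by apply: ereal_inf_lbound; exists B.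
  apply: lee_nneseries => [k _ _|k _]; first exact: wlength_ge0.
  case: (mB k) => -[a b] _ <- /=; rewrite !wlength_itv/= lte_fin.
  case: ifPn => ab; last by rewrite mule0.
  rewrite -!EFinD -EFinM lee_fin /F.
  have := hL b a; rewrite ler_norml ger0_norm ?subr_ge0; last exact: ltW.
  move=> /andP[]; lra.
Qed.


(** The window []-1, 2]] has room 1 on both sides of [[0, 1]], so [s + 1/(k+1)] stays in it;
    restriction to it makes the Stieltjes measure finite for Radon-Nikodym. *)
Let mD : measurable (`]-1, 2]%classic : set (measurableTypeR R)).
Proof. exact: measurable_itv. Qed.

Let muoc a b : a <= b -> mu `]a, b]%classic = (F b - F a)%:E.
Proof.
move=> ab; rewrite /mu /lebesgue_stieltjes_measure /measure_extension.
rewrite measurable_mu_extE/=; last exact: is_ocitv.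
exact: wlength_itv_bnd.
Qed.

Let muD : (mu `](-1)%R, 2%R]%classic < +oo)%E.
Proof. by rewrite muoc ?ltry//; lra. Qed.

Let nu := mfrestr mD muD.

Let nu_lambda : nu `<< lambda.
Proof.
apply/null_content_dominatesP => A mA A0.
rewrite /nu /mfrestr /mrestr.
apply/eqP; rewrite eq_le measure_ge0 andbT.
apply: (@le_trans _ _ (mu A)).
  by apply: measureIl => //.
have := mu_le A; rewrite A0 lee_pdivrMl ?mule0//.
by rewrite mulrn_wgt0.
Qed.

(** [g] is the Radon-Nikodym density of the restricted Stieltjes measure. On the window its
    primitive is [F] up to a constant, so Lebesgue differentiation gives [F' = g], that is
    [h' = g - L], almost everywhere. *)
Lemma lipschitz1_density : exists2 g : R -> R, (forall s, 0 <= g s) &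
  [/\ lambda.-integrable setT (EFin \o g),
    (h 1 - h 0 + L)%:E = (\int[lambda]_(s in `]0%R, 1%R]) (g s)%:E)%E &
    {ae lambda, forall s, `]0, 1[%classic s ->
      diffquo (h : R^o -> R) 1 s @ \oo --> g s - L}].
Proof.
have [f [f0 ffin intf nuE]] := radon_nikodym_sigma_finite nu_lambda.
pose g := fine \o f.
have gE : EFin \o g = f by apply/funext => x /=; rewrite fineK.
have intg : lambda.-integrable setT (EFin \o g) by rewrite gE.
have FE a b : -1 <= a -> a <= b -> b <= 2 ->
    (F b - F a)%:E = (\int[lambda]_(s in `]a, b]) (g s)%:E)%E.
  move=> a1 ab b2; under eq_integral do rewrite fineK//.
  rewrite -nuE; last exact: measurable_itv.
  transitivity (mu (`]a, b]%classic `&` `](-1)%R, 2%R]%classic)); last by [].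
  rewrite setIidl ?muoc//.
  by apply: subset_itv; rewrite bnd_simp.
exists g => [s|]; first exact: fine_ge0.
split => //.
  have [h1 h2 h3] : [/\ -1 <= 0 :> R, 0 <= 1 :> R & 1 <= 2 :> R] by split; lra.
  by rewrite -(FE _ _ h1 h2 h3); congr (_%:E); rewrite /F; ring.
have locg : locally_integrable setT g.
  split=> //; first by have /integrableP[/measurable_EFinP] := intg.
    exact: openT.
  move=> K _ cK; have /integrableP[mg] := intg.
  apply: le_lt_trans; apply: ge0_subset_integral => //.
    exact: compact_measurable.
  by apply/measurable_EFinP/measurableT_comp => //; exact/measurable_EFinP.
have := @FTC1 R g (BRight (-1)) _ locg.
have intgS y : lambda.-integrable [set` Interval (BRight (-1)) (BRight y)] (EFin \o g).
  by apply: integrableS intg => //; exact: measurable_itv.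
move=> /(_ intgS); apply: filterS.
  exact: (ae_filter_ringOfSetsType lambda).
move=> s /=; rewrite in_itv/= => + /andP[s0 s1].
(* [G] is the primitive of [g] from -1; on the window it equals [F - F (-1)]. *)
set G := (fun y => _).
have G1 y : -1 <= y -> y <= 2 -> G y = F y - F (-1).
  move=> y1 y2; rewrite /G /Rintegral.
  by rewrite -FE.
move=> /(_ _)[]; first by rewrite ?lte_fin ?bnd_simp; lra.
move=> dG Gs.
have {dG}Gs : e^-1 *: (G (e + s) - G s) @[e --> 0^'] --> g s.
  rewrite -Gs derive1E; move: dG; rewrite /derivable /derive.
  set q := (fun e : R => _); set q' := (fun e : R => e^-1 *: _).
  suff <- : q = q' by [].
  by apply/funext => e; rewrite /q /q' /= [e *: 1]mulr1.
(* The steps [1/(k+1)] tend to 0 and avoid 0, as the punctured limit requires. *)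
have invn0 : (fun k => k.+1%:R^-1 : R) @ \oo --> 0^'.
  move=> A [e/= e0 eA].
  change (\forall k \near \oo, A (k.+1%:R^-1)).
  near=> k; apply: eA => /=; last by rewrite invr_eq0 pnatr_eq0.
  rewrite sub0r normrN ger0_norm//.
  by near: k; exact: (near_infty_natSinv_lt (PosNum e0)).
have GsL := cvgB (cvg_comp _ _ invn0 Gs) (cvg_cst L).
suff -> : diffquo (h : R^o -> R) 1 s =
    fun k : nat => k.+1%:R^-1^-1 *: (G (k.+1%:R^-1 + s) - G s) - L.
  exact: GsL.
apply/funext => k.
have k1 : k.+1%:R^-1 <= 1 :> R by rewrite invf_le1 ?ler1n.
have k0 : 0 < k.+1%:R^-1 :> R by rewrite invr_gt0.
have kk : k.+1%:R != 0 :> R by rewrite pnatr_eq0.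
have [b1 b2] : -1 <= k.+1%:R^-1 + s /\ k.+1%:R^-1 + s <= 2.
  by move: k0 k1; move: (k.+1%:R^-1 : R) => r r0 r1; split; lra.
have [b3 b4] : -1 <= s /\ s <= 2 by split; lra.
rewrite /diffquo !G1//.
have scaleE (a b : R) : a *: (b : R^o) = a * b by [].
rewrite /F invrK [_ *: 1]mulr1 scaleE (addrC s).
move: kk; move: (k.+1%:R : R) => r r0.
by field.
Unshelve. all: by end_near. Qed.

Lemma lipschitz1_ae_cvg : {ae lambda, forall s, `]0, 1[%classic s ->
  cvgn (diffquo (h : R^o -> R) 1 s)}.
Proof.
have [g _ [_ _]] := lipschitz1_density; apply: filterS.
  exact: (ae_filter_ringOfSetsType lambda).
by move=> s hs /hs; apply: cvgP.
Qed.

(** Integrating [g <= a + L] over the unit interval bounds [h 1 - h 0 + L]. The premise [0 <= a + L]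
    allows the comparison of integrals of nonnegative functions. *)
Lemma lipschitz1_ae_le0 (a : R) : 0 <= a + L ->
  {ae lambda, forall s, `]0, 1[%classic s ->
    limn (diffquo (h : R^o -> R) 1 s) <= a} -> h 1 - h 0 <= a.
Proof.
move=> aL0 ae_a; have [g g0 [intg hg ae_g]] := lipschitz1_density.
rewrite -(lerD2r L) -lee_fin hg.
have /integrableP[mg _] := intg.
have mgS (D : set (measurableTypeR R)) : measurable_fun D (EFin \o g).
  exact: measurable_funTS.
rewrite -integral_itv_bndo_bndc; last exact: mgS.
have l1 : lambda `]0%R, 1%R[%classic = 1%E.
  by rewrite lebesgue_measure_itv/= lte_fin ltr01 sube0.
have <- : (\int[lambda]_(x in `]0%R, 1%R[) (cst (a + L)%:E x) = (a + L)%:E)%E.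
  rewrite integral_cst//.
  by transitivity ((a + L)%:E * 1)%E; [congr (_ * _)%E|rewrite mule1].
apply: ae_ge0_le_integral => //.
  by move=> s _; rewrite lee_fin.
move: ae_a ae_g; apply: filterS2; first exact: (ae_filter_ringOfSetsType lambda).
move=> s as_ gs s01; rewrite lee_fin -lerBlDr.
by rewrite -(cvg_lim _ (gs s01))//; exact: as_.
Qed.

End lipschitz1.

(** Enlarging the Lipschitz constant to [L + |a|] makes the sign premise automatic. *)
Lemma lipschitz1_ae_le {R : realType} (h : R -> R) (L a : R) :
  0 < L -> (forall s t, `|h s - h t| <= L * `|s - t|) ->
  {ae @lebesgue_measure R, forall s, `]0, 1[%classic s ->
    limn (diffquo (h : R^o -> R) 1 s) <= a} -> h 1 - h 0 <= a.
Proof.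
move=> L0 hL; apply: (@lipschitz1_ae_le0 _ _ (L + `|a|)).
- by rewrite ltr_wpDr.
- by move=> s t; rewrite (le_trans (hL s t))// ler_wpM2r// lerDl.
- by have := ler_norm (- a); rewrite normrN; lra.
Qed.

(** * Sup-norm estimates for matrices, and differentials in epsilon form *)

Section matrix_norm.
Context {R : realType}.

Lemma coord_le_norm m n (A : 'M[R]_(m, n)) i j : `|A i j| <= `|A|.
Proof.
rewrite [leRHS]/Num.norm/= mx_normrE.
by apply: (le_bigmax _ (fun ij : 'I_m * 'I_n => `|A ij.1 ij.2|) (i, j)).
Qed.

Lemma norm_le_coord m n (A : 'M[R]_(m, n)) e : 0 <= e ->
  (forall i j, `|A i j| <= e) -> `|A| <= e.
Proof.
move=> e0 Ae; rewrite [leLHS]/Num.norm/= mx_normrE.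
by apply/bigmax_leP; split=> // -[i j] _; exact: Ae.
Qed.

(** The sup norm is not submultiplicative: an entry of the product is a sum of [n] terms, whence the
    factor. *)
Lemma norm_mulmx_le m n p (A : 'M[R]_(m, n)) (B : 'M[R]_(n, p)) :
  `|A *m B| <= n%:R * `|A| * `|B|.
Proof.
apply: norm_le_coord => [|i j]; first by rewrite !mulr_ge0.
rewrite mxE (le_trans (ler_norm_sum _ _ _))//.
apply: (@le_trans _ _ (\sum_(k < n) `|A| * `|B|)).
  by apply: ler_sum => k _; rewrite normrM ler_pM// coord_le_norm.
by rewrite sumr_const card_ord -mulrA mulr_natl.
Qed.

Definition pairing n (c : 'cV[R]_n) (h : 'rV[R]_n) : R := (h *m c) ord0 ord0.

Lemma pairing_is_linear n (c : 'cV[R]_n) : linear (pairing c).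
Proof. by move=> a u v; rewrite /pairing mulmxDl -scalemxAl !mxE. Qed.

HB.instance Definition _ n (c : 'cV[R]_n) :=
  GRing.isLinear.Build R 'rV[R]_n R *:%R (pairing c) (pairing_is_linear c).

Lemma pairing_le n (c : 'cV[R]_n) h : `|pairing c h| <= n%:R * `|c| * `|h|.
Proof.
rewrite (le_trans (coord_le_norm _ _ _))// (le_trans (norm_mulmx_le _ _))//.
by rewrite mulrAC.
Qed.

Lemma pairing_continuous n (c : 'cV[R]_n) : continuous (pairing c).
Proof.
apply/linear_bounded_continuous/linear_boundedP.
exists (n%:R * `|c|); split; first exact: num_real.
by move=> M /ltW nM h; rewrite (le_trans (pairing_le _ _))// ler_wpM2r.
Qed.

End matrix_norm.

Section differential_eps.
Context {R : realType} {V W : normedModType R}.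
Implicit Types f : V -> W.

(** Little-o in epsilon form; uniqueness of the differential identifies the candidate [df]. *)
Lemma diff_eps f (df : {linear V -> W}) x : continuous df ->
  (forall e, 0 < e -> \forall h \near (0 : V), `|f (x + h) - f x - df h| <= e * `|h|) ->
  differentiable f x /\ 'd f x = df :> (V -> W).
Proof.
move=> dfc feps.
have fo : f \o shift x = cst (f x) + df +o_ 0 id.
  apply/eqaddoP => e e0; have := feps _ e0.
  apply: filter_app; near=> h.
  rewrite (_ : (_ - _) h = f (x + h) - f x - df h)//.
  transitivity (f (h + x) - (f x + df h)); first by [].
  by rewrite opprD addrA (addrC h).
have df_eq := diff_unique dfc fo.
split=> //; apply/diff_locallyP; split; first by rewrite df_eq.
by rewrite [in X in _ = X]df_eq.
Unshelve. all: by end_near. Qed.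

Lemma differentiable_eps f x e : differentiable f x -> 0 < e ->
  \forall h \near (0 : V), `|f (x + h) - f x - 'd f x h| <= e * `|h|.
Proof.
move=> /diff_locally /eqaddoP /(_ e) + e0 => /(_ e0); apply: filter_app; near=> h.
rewrite (_ : (_ - _) h = f (x + h) - f x - 'd f x h)//.
transitivity (f (h + x) - (f x + 'd f x h)); first by [].
by rewrite opprD addrA (addrC h).
Unshelve. all: by end_near. Qed.

End differential_eps.

(** * Differentiability from difference quotients in integer directions *)

Lemma absz_shift (z : int) (M : nat) : `|z| <= M%:Z ->
  (absz (z + M%:Z)%R < M.*2.+1)%N /\ z = (absz (z + M%:Z))%:Z - M%:Z.
Proof. by move=> zM; split; lia. Qed.

Section integer_directions.
Context {R : realType} {n : nat}.

Definition introw (z : 'rV[int]_n) : 'rV[R]_n := map_mx intr z.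

Section differentiable.
Variables (f : 'rV[R]_n -> R) (L : R) (x : 'rV[R]_n) (D : 'rV[int]_n -> R).
Hypothesis L_gt0 : 0 < L.
Hypothesis fL : forall u v, `|f u - f v| <= L * `|u - v|.
Hypothesis D_additive : forall z w, D (z + w) = D z + D w.
Hypothesis D_lim : forall z, diffquo f (introw z) x @ \oo --> D z.

Let D0 : D 0 = 0.
Proof. by have := D_additive 0 0; rewrite addr0; lra. Qed.

Let DB : {morph D : z w / z - w}.
Proof. by move=> z w; have := D_additive (z - w) w; rewrite subrK => ->; rewrite addrK. Qed.

HB.instance Definition _ := GRing.isZmodMorphism.Build _ _ D DB.

Let c : 'cV[R]_n := \col_i D (delta_mx ord0 i).

Let DE z : D z = (introw z *m c) ord0 ord0.
Proof.
rewrite [in LHS](row_sum_delta z) raddf_sum mxE; apply: eq_bigr => i _.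
transitivity (D (delta_mx ord0 i *~ z ord0 i)); first by rewrite -scaler_int intz.
by rewrite raddfMz !mxE mulrzl.
Qed.

(** After scaling by [k+1] and rounding, only finitely many integer directions occur, and on these
    the quotients converge uniformly; the Lipschitz bound absorbs the rounding. *)
Lemma lipschitz_integer_differentiable : differentiable f x.
Proof.
suff: forall e, 0 < e -> \forall h \near (0 : 'rV[R]_n),
    `|f (x + h) - f x - pairing c h| <= e * `|h|.
  by case/(diff_eps (@pairing_continuous _ _ c)).
move=> e e0.
have L0 : 0 <= L by exact: ltW.
(* Three errors of order [1/(k+1)] are collected: [L] for rounding in [f], [n |c|] for rounding in
   the linear form, 1 for the quotients. [K] is chosen so that [C / K <= e]. *)
pose C := L + n%:R * `|c| + 1.
have C0 : 0 < C by rewrite /C; apply: ltr_wpDl => //; rewrite addr_ge0// mulr_ge0.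
pose K := (Num.trunc (C / e)).+1.
have K0 : 0 < K%:R :> R by rewrite ltr0n.
have CK : C / K%:R <= e.
  rewrite ler_pdivrMr// -ler_pdivrMl// mulrC ltW//.
  by have /andP[] := truncn_itv (divr_ge0 (ltW C0) (ltW e0)).
(* Coordinates of the rounded direction lie between [-(K+2)] and [K+2]: [K + 1] for the scaled
   increment and 1 for rounding. [zz] lists these directions by shifted naturals. *)
pose S := K.+2.*2.+1.
pose zz (a : {ffun 'I_n -> 'I_S}) : 'rV[int]_n := \row_i ((a i : nat)%:Z - K.+2%:Z).
have : \forall k \near \oo, forall a, `|diffquo f (introw (zz a)) x k - D (zz a)| <= 1.
  apply: filter_forall => a.
  by have /cvgrPdist_le/(_ 1 ltr01) := @D_lim (zz a); apply: filterS => k; rewrite distrC.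
move=> [k0 _ hk0].
near=> h.
have h1 : `|h| <= 1.
  by near: h; exact: (@nbhs0_le R 'rV[R]_n).
have hk : `|h| <= K%:R / k0.+1%:R.
  by near: h; apply: (@nbhs0_le R 'rV[R]_n); rewrite divr_gt0.
have [->|h0] := eqVneq h 0.
  by rewrite addr0 subrr raddf0 subrr !normr0 mulr0.
have hn0 : 0 < `|h| by rewrite normr_gt0.
(* This choice gives [1/(k+1) < |h|/K] and also [(k+1) |h| <= K + 1]. *)
pose k := Num.trunc (K%:R / `|h|).
have /andP[kle klt] := truncn_itv (divr_ge0 (ltW K0) (ltW hn0)); rewrite -/k in kle klt.
pose z : 'rV[int]_n := \row_i Num.floor (k.+1%:R * h ord0 i).
have kk0 : (k0 <= k)%N.
  rewrite -ltnS -(ltr_nat R) (le_lt_trans _ klt)//.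
  rewrite ler_pdivlMr// (le_trans (ler_wpM2l _ hk))// mulrCA.
  by rewrite ler_piMr ?ler0n// ler_pdivrMr// mul1r ler_nat.
have khK : `|k.+1%:R *: h| <= K%:R + 1.
  rewrite normrZ ger0_norm// -natr1 mulrDl mul1r lerD//.
  by rewrite -ler_pdivlMr.
have zh : `|k.+1%:R *: h - introw z| <= 1.
  apply: norm_le_coord => // i j; rewrite ord1 !mxE.
  have /andP[z1 z2] := floor_itv (k.+1%:R * h ord0 j).
  by rewrite ger0_norm ?subr_ge0// lerBlDr addrC -intrD1 ltW.
have zK i : `|z ord0 i| <= K.+2%:Z.
  rewrite -(ler_int R) intr_norm.
  have -> : (z ord0 i)%:~R = (k.+1%:R *: h) ord0 i - (k.+1%:R *: h - introw z) ord0 i.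
    by rewrite !mxE; ring.
  rewrite (le_trans (ler_normB _ _))//.
  rewrite (le_trans (lerD (coord_le_norm _ _ _) (coord_le_norm _ _ _)))//.
  rewrite (le_trans (lerD khK zh))// -addrA.
  by rewrite -[K.+2]addn2 PoszD intrD.
have [a za] : exists a, z = zz a.
  exists [ffun i => inord (absz (z ord0 i + K.+2%:Z))].
  apply/rowP => i; rewrite [RHS]mxE ffunE inordK; by have [] := absz_shift (zK i).
have k10 : 0 < k.+1%:R :> R by [].
have hz : `|h - k.+1%:R^-1 *: introw z| <= k.+1%:R^-1.
  rewrite -[X in X <= _](@mulKf _ k.+1%:R) ?gt_eqF// ler_piMr ?invr_ge0//.
  rewrite -{1}[k.+1%:R]ger0_norm// -normrZ scalerBr scalerA mulfV ?gt_eqF//.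
  by rewrite scale1r.
have le1 : `|f (x + h) - f x - pairing c h| <= C / k.+1%:R.
  have -> : f (x + h) - f x - pairing c h =
      (f (x + h) - f (x + k.+1%:R^-1 *: introw z)) +
      k.+1%:R^-1 * (diffquo f (introw z) x k - D z) -
      pairing c (h - k.+1%:R^-1 *: introw z).
    have -> : pairing c (h - k.+1%:R^-1 *: introw z) =
        pairing c h - k.+1%:R^-1 * D z.
      by rewrite DE /pairing mulmxBl -scalemxAl !mxE.
    by rewrite /diffquo; field; rewrite gt_eqF.
  rewrite (le_trans (ler_normB _ _))// (le_trans (lerD (ler_normD _ _) (lexx _)))//.
  rewrite (le_trans (lerD (lerD (fL _ _) (lexx _)) (pairing_le _ _)))//.
  rewrite opprD addrACA subrr add0r normrM (ger0_norm (x := _^-1))//.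
  have -> : C / k.+1%:R = L * k.+1%:R^-1 + k.+1%:R^-1 * 1 + n%:R * `|c| * k.+1%:R^-1.
    by rewrite /C; ring.
  rewrite !lerD ?ler_wpM2l ?mulr_ge0 ?invr_ge0//.
  by rewrite za; exact: hk0.
rewrite (le_trans le1)//.
have : k.+1%:R^-1 <= `|h| / K%:R.
  by rewrite -[leRHS]invrK lef_pV2 ?posrE ?invr_gt0 ?divr_gt0// invf_div ltW.
move=> /(ler_wpM2l (ltW C0)) /le_trans; apply.
by rewrite mulrCA mulrC ler_wpM2r.
Unshelve. all: by end_near. Qed.

End differentiable.

End integer_directions.

(** * Measurability of convergence, and integrals of bounded functions with bounded support *)

Lemma measurable_cvgn d (T : measurableType d) (R : realType)
    (h : nat -> T -> R) : (forall k, measurable_fun setT (h k)) ->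
  measurable [set t | cvgn (h ^~ t)].
Proof.
move=> mh.
(* Cauchy criterion with tolerances [1/(j+1)]: only countable quantifiers remain. *)
rewrite (_ : [set t | _] = \bigcap_j \bigcup_N \bigcap_k
   [set t | `|h N t - h (N + k)%N t| < j.+1%:R^-1]).
  apply: bigcapT_measurable => j; apply: bigcupT_measurable => N.
  apply: bigcapT_measurable => k.
  have mN : measurable_fun setT (fun t => `|h N t - h (N + k)%N t|).
    by apply: measurableT_comp => //; exact: measurable_funB.
  have := mN measurableT `]-oo, j.+1%:R^-1[%classic (measurable_itv _).
  by rewrite setTI; congr measurable; apply/seteqP; split=> t; rewrite /= in_itv.
apply/seteqP; split=> t /=.
  move=> /cvgrPdist_lt ht j _.
  have j0 : 0 < j.+1%:R^-1 / 2 :> R by rewrite divr_gt0 ?invr_gt0.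
  have [N _ hN] := ht _ j0; exists N => // k _ /=.
  rewrite [X in _ < X]splitr -(subrKA (limn (h ^~ t))) (le_lt_trans (ler_normD _ _))//.
  rewrite ltrD//; last by apply: hN; rewrite /= leq_addr.
  by rewrite distrC; apply: hN => /=.
move=> ht; apply/cauchy_cvgP/cauchy_exP => e e0.
have [j _ /(_ j (leqnn _)) je] := near_infty_natSinv_lt (PosNum e0).
have [N _ hN] := ht j Logic.I; exists (h N t), N => // k /= Nk.
rewrite -ball_normE /=; have := hN (k - N)%N Logic.I.
by rewrite /= subnKC// => /lt_trans; apply.
Qed.

(** The index type is embedded in the naturals by [pickle]; a number that codes no index gets the
    trivial property. *)
Lemma ae_forall_countable d (T : measurableType d) (R : realType)
    (m : {measure set T -> \bar R}) (I : countType) (P : I -> T -> Prop) :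
  (forall i, {ae m, forall t, P i t}) -> {ae m, forall t, forall i, P i t}.
Proof.
move=> aeP.
pose Q k t := if unpickle k is Some i then P i t else True.
have : {ae m, forall t, forall k, Q k t}.
  apply: ae_foralln => k; rewrite /Q; case: unpickle => [i|]; first exact: aeP.
  exact: aeW.
by apply: filterS => t Qt i; have := Qt (pickle i); rewrite /Q pickleK.
Qed.

Section bounded_support.
Context {R : realType} {n : nat}.
Local Notation mu := (lebesgue_tuple R n).
Local Notation rho := (@row_of_tuple R n).
Implicit Types phi psi : 'rV[R]_n -> R.

(** Such functions are dominated by [C] times the indicator of a ball, which gives integrability and
    a common bound for dominated convergence. *)
Definition bounded_supp (C M : R) phi :=
  forall x, `|phi x| <= C /\ (M <= `|x| -> phi x = 0).

Definition row_measurable phi := measurable_fun setT (phi \o rho).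

Definition row_integral phi : \bar R := (\int[mu]_t (phi (rho t))%:E)%E.

Let dominating C M (t : n.-tuple (measurableTypeR R)) : \bar R :=
  (C%:E * (\1_(rho @^-1` ball 0 M) t)%:E)%E.

Let integrable_dominating C M : 0 < M ->
  mu.-integrable setT (dominating C M).
Proof.
move=> M0; have mB := @measurable_row_of_tuple_ball R n 0 _ M0.
apply: integrableZl => //; apply/integrableP; split.
  by apply/measurable_EFinP; exact: measurable_indic.
rewrite (eq_integral (fun t => (\1_(rho @^-1` ball 0 M) t)%:E)); last first.
  by move=> t _; rewrite gee0_abs// lee_fin.
rewrite integral_indic// setIT.
have : (mu (rho @^-1` ball 0%R M) < +oo)%E by rewrite lebesgue_tuple_ball// ltry.
exact.
Qed.

Let le_dominating C M phi t : bounded_supp C M phi ->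
  (`|(phi (rho t))%:E| <= dominating C M t)%E.
Proof.
move=> /(_ (rho t))[phiC phiM]; rewrite /dominating -EFinM lee_fin indicE.
have [tM|tM] := boolP (t \in _); first by rewrite mulr1.
rewrite phiM ?normr0 ?mulr0// leNgt; apply: contra tM => tM.
by rewrite inE /= -ball_normE /= sub0r normrN.
Qed.

Lemma bounded_supp_integrable C M phi : 0 < M -> row_measurable phi ->
  bounded_supp C M phi -> mu.-integrable setT (fun t => (phi (rho t))%:E).
Proof.
move=> M0 mphi sphi; apply: (le_integrable measurableT _ _ (integrable_dominating C M0)).
  exact/measurable_EFinP.
by move=> t _; rewrite (le_trans (le_dominating t sphi))// lee_abs.
Qed.

Lemma bounded_supp_cvg C M (h : nat -> 'rV[R]_n -> R) phi : 0 < M ->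
  (forall k, row_measurable (h k)) -> (forall k, bounded_supp C M (h k)) ->
  row_measurable phi ->
  {ae mu, forall t, h ^~ (rho t) @ \oo --> phi (rho t)} ->
  row_integral \o h @ \oo --> row_integral phi.
Proof.
move=> M0 mh sh mphi hphi.
have [] := @dominated_convergence _ _ _ mu setT measurableT
  (fun k t => (h k (rho t))%:E) (fun t => (phi (rho t))%:E) (dominating C M).
- by move=> k; apply/measurable_EFinP; exact: mh.
- exact/measurable_EFinP.
- by move: hphi; apply: filterS => t ht _; apply: cvg_EFin => //; exact: nearW.
- exact: integrable_dominating.
- by apply: aeW => t k _; exact: le_dominating.
by [].
Qed.

Lemma bounded_supp_translate C M phi a : bounded_supp C M phi ->
  bounded_supp C (M + `|a|) (fun x => phi (x + a)).
Proof.
move=> sphi x; have [phiC phiM] := sphi (x + a); split=> // Mx; apply: phiM.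
by rewrite -(lerD2r `|a|) (le_trans Mx)// -{1}[x](addrK a) ler_normB.
Qed.

Lemma row_measurable_translate phi a : row_measurable phi ->
  row_measurable (fun x => phi (x + a)).
Proof.
move=> mphi; rewrite /row_measurable.
rewrite (_ : _ \o _ = (phi \o rho) \o translate a); last first.
  by apply/funext => t; rewrite /= row_of_translate.
by apply: measurableT_comp => //; exact: measurable_translate.
Qed.

(** Invariance of the measure, read as equality of [mu] with its image under [translate a]. *)
Lemma row_integral_translate C M phi a : 0 < M -> row_measurable phi ->
  bounded_supp C M phi -> row_integral (fun x => phi (x + a)) = row_integral phi.
Proof.
move=> M0 mphi sphi.
rewrite /row_integral.
transitivity (\int[pushforward mu (translate a)]_t (phi (rho t))%:E)%E; last first.
  apply: eq_measure_integral; first exact: measurable_translate.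
  by move=> ? A mA _; exact: lebesgue_tuple_translate.
rewrite integral_pushforward//.
- by apply: eq_integral => t _; rewrite /= row_of_translate.
- exact: measurable_translate.
- exact/measurable_EFinP.
- have sphi' := bounded_supp_translate a sphi.
  rewrite preimage_setT; set F := (F in mu.-integrable _ F).
  rewrite (_ : F = fun t => (phi (rho t + a))%:E); last first.
    by apply/funext => t; rewrite /F /= row_of_translate.
  apply: bounded_supp_integrable sphi'; first exact: ltr_wpDr.
  exact: row_measurable_translate.
Qed.

Lemma row_measurableM phi psi : row_measurable phi -> row_measurable psi ->
  row_measurable (fun x => phi x * psi x).
Proof. by move=> mphi mpsi; exact: measurable_funM. Qed.

Lemma row_measurableB phi psi : row_measurable phi -> row_measurable psi ->
  row_measurable (fun x => phi x - psi x).
Proof. by move=> mphi mpsi; exact: measurable_funB. Qed.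

Lemma bounded_suppM C M C' psi phi : 0 <= C -> (forall x, `|psi x| <= C) ->
  bounded_supp C' M phi -> bounded_supp (C * C') M (fun x => psi x * phi x).
Proof.
move=> C0 psiC sphi x; have [phiC phiM] := sphi x; split.
  by rewrite normrM ler_pM.
by move=> /phiM ->; rewrite mulr0.
Qed.

Lemma row_integralB C M C' M' phi psi : 0 < M -> 0 < M' ->
  row_measurable phi -> bounded_supp C M phi ->
  row_measurable psi -> bounded_supp C' M' psi ->
  (row_integral (fun x => phi x - psi x)%R = row_integral phi - row_integral psi)%E.
Proof.
move=> M0 M'0 mphi sphi mpsi spsi; rewrite /row_integral.
under eq_integral do rewrite EFinB.
by rewrite integralB_EFin//; [exact: bounded_supp_integrable sphi|
  exact: bounded_supp_integrable spsi].
Qed.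

(* Summation by parts: translation invariance moves the difference from one
   factor to the other. *)
Lemma row_integral_by_parts C M C' phi psi a : 0 < M -> 0 <= C' ->
  row_measurable phi -> bounded_supp C M phi ->
  row_measurable psi -> (forall x, `|psi x| <= C') ->
  row_integral (fun x => (phi (x + a) - phi x) * psi x) =
  row_integral (fun x => (psi (x - a) - psi x) * phi x).
Proof.
move=> M0 C'0 mphi sphi mpsi psiC'.
have mpsia := row_measurable_translate (- a) mpsi.
have sF : bounded_supp (C' * C) M (fun x => psi (x - a) * phi x).
  exact: (bounded_suppM (psi := fun x => psi (x - a))).
have mF : row_measurable (fun x => psi (x - a) * phi x).
  exact: row_measurableM.
have sG : bounded_supp (C' * C) M (fun x => psi x * phi x) by exact: bounded_suppM.
have mG : row_measurable (fun x => psi x * phi x) by exact: row_measurableM.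
have Ma : 0 < M + `|a| by rewrite ltr_wpDr.
transitivity (row_integral (fun x => psi (x - a) * phi x)%R -
              row_integral (fun x => psi x * phi x)%R)%E; last first.
  rewrite -(row_integralB M0 M0 mF sF mG sG); apply: eq_integral => t _.
  by congr (_%:E); ring.
rewrite -(row_integral_translate a M0 mF sF).
rewrite -(row_integralB Ma M0 (row_measurable_translate a mF)
  (bounded_supp_translate a sF) mG sG).
by apply: eq_integral => t _; rewrite addrK; congr (_%:E); ring.
Qed.

Lemma row_integral_sqr_eq0 phi : row_measurable phi ->
  row_integral (fun x => phi x * phi x) = 0%E ->
  {ae mu, forall t, phi (rho t) = 0}.
Proof.
move=> mphi phi0.
have mf : measurable_fun setT (fun t => (phi (rho t) * phi (rho t))%:E).
  by apply/measurable_EFinP; exact: row_measurableM.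
have /(ae_eq_integral_abs mu measurableT mf) :
    (\int[mu]_t `|(phi (rho t) * phi (rho t))%:E| = 0)%E.
  rewrite -[RHS]phi0; apply: eq_integral => t _.
  by rewrite gee0_abs// lee_fin -expr2 sqr_ge0.
apply: filterS => t /(_ Logic.I) [] /eqP.
by rewrite -expr2 sqrf_eq0 => /eqP.
Qed.

End bounded_support.

(** * Rademacher's theorem for compactly supported scalar functions *)

Section rademacher.
Context {R : realType} {n : nat}.
Local Notation mu := (lebesgue_tuple R n).
Local Notation rho := (@row_of_tuple R n).
Variables (f : 'rV[R]_n -> R) (L M : R).
Hypothesis L_gt0 : 0 < L.
Hypothesis M_gt0 : 0 < M.
Hypothesis fL : forall u v, `|f u - f v| <= L * `|u - v|.
Hypothesis fM : forall u, M <= `|u| -> f u = 0.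

Let f_continuous : continuous f.
Proof. exact: lipschitz_continuous fL. Qed.

Let mf : row_measurable f.
Proof. exact: continuous_measurable_tuple. Qed.

Let mq v k : row_measurable (fun x => diffquo f v x k).
Proof.
apply: (row_measurableM (phi := cst k.+1%:R)); first exact: measurable_cst.
by apply: row_measurableB => //; exact: row_measurable_translate.
Qed.

Let qL v x k : `|diffquo f v x k| <= L * `|v|.
Proof.
rewrite /diffquo normrM ger0_norm// mulrC -ler_pdivlMr//.
by rewrite (le_trans (fL _ _))// addrAC subrr add0r normrZ ger0_norm// mulrCA mulrC.
Qed.

Let qM v k : bounded_supp (L * `|v|) (M + `|v|) (fun x => diffquo f v x k).
Proof.
move=> x; split; first exact: qL.
move=> Mx; rewrite /diffquo !fM ?subrr ?mulr0//.
  by rewrite (le_trans _ Mx)// lerDl.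
have : `|k.+1%:R^-1 *: v| <= `|v|.
  by rewrite normrZ ger0_norm// ler_piMl// invf_le1// ler1n.
move=> vk; rewrite -(lerD2r `|k.+1%:R^-1 *: v|).
rewrite (le_trans (lerD (lexx _) vk))// (le_trans Mx)//.
by rewrite -{1}[x](addrK (k.+1%:R^-1 *: v)) ler_normB.
Qed.

Let q_lip v k x y : `|diffquo f v x k - diffquo f v y k| <= k.+1%:R * (L + L) * `|x - y|.
Proof.
rewrite /diffquo -mulrBr normrM ger0_norm// -mulrA ler_wpM2l//.
set a := _ *: v.
have -> : f (x + a) - f x - (f (y + a) - f y) = f (x + a) - f (y + a) + (f y - f x).
  by ring.
rewrite mulrDl (le_trans (ler_normD _ _))// lerD//.
  by rewrite (le_trans (fL _ _))// opprD addrACA subrr addr0.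
by rewrite (le_trans (fL _ _))// distrC.
Qed.

Lemma diffquo_line v x s k :
  diffquo ((fun s => f (x + s *: v)) : R^o -> R) 1 s k = diffquo f v (x + s *: v) k.
Proof.
rewrite /diffquo; congr (_ * (f _ - _)).
by rewrite -addrA -scalerDl; congr (_ + (_ + _) *: _); rewrite [LHS]mulr1.
Qed.

(** The summand 1 keeps the constant positive when [v = 0]. *)
Lemma line_lipschitz v x s t :
  `|f (x + s *: v) - f (x + t *: v)| <= (L * `|v| + 1) * `|s - t|.
Proof.
rewrite (le_trans (fL _ _))// opprD addrACA subrr add0r -scalerBl normrZ.
by rewrite mulrDl mul1r [X in X <= _]mulrCA mulrC lerDl.
Qed.

(** On each line [f] is a Lipschitz function of one variable, so the divergence set meets every
    segment in a null set, and [null_lines] applies. *)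
Lemma ae_cvg_diffquo v : {ae mu, forall t, cvgn (diffquo f v (rho t))}.
Proof.
pose A := ~` [set t | cvgn (diffquo f v (rho t))].
have mA : measurable A.
  apply: measurableC.
  by apply: (measurable_cvgn (h := fun k t => diffquo f v (rho t) k)) => k; exact: (mq v k).
exists A; split => //; apply: (null_lines (v := v)) => // t.
have Lv : 0 < L * `|v| + 1 by rewrite ltr_wpDl// mulr_ge0// ltW.
have := lipschitz1_ae_cvg Lv (line_lipschitz v (rho t)).
apply: negligibleS => s [s01]; rewrite /A /= row_of_translate => As hs; apply: As.
have := hs s01; suff -> : diffquo ((fun s => f (rho t + s *: v)) : R^o -> R) 1 s =
  diffquo f v (rho t + s *: v) by [].
by apply/funext => k; exact: diffquo_line.
Qed.

(* Truncating makes [limquo] bounded also where the quotients diverge. *)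
Definition limquo v x : R :=
  Num.max (- (L * `|v|)) (Num.min (L * `|v|) (limn_sup (diffquo f v x))).

Let limquo_le v x : `|limquo v x| <= L * `|v|.
Proof.
have v0 : 0 <= L * `|v| by rewrite mulr_ge0// ltW.
rewrite ler_norml /limquo le_max lexx/= ge_max ge_min lexx/= andbT.
by rewrite (le_trans _ v0)// oppr_le0.
Qed.

Let limquo_lim v x : cvgn (diffquo f v x) -> diffquo f v x @ \oo --> limquo v x.
Proof.
move=> cq; rewrite /limquo cvg_limn_supE//.
have qle k : - (L * `|v|) <= diffquo f v x k <= L * `|v| by rewrite -ler_norml qL.
have lle : limn (diffquo f v x) <= L * `|v|.
  by apply: limr_le => //; apply: nearW => k; have /andP[] := qle k.
have lge : - (L * `|v|) <= limn (diffquo f v x).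
  by apply: limr_ge => //; apply: nearW => k; have /andP[] := qle k.
by rewrite min_r// max_r.
Qed.

Let limquo_measurable v : row_measurable (limquo v).
Proof.
apply: measurable_maxr; first exact: measurable_cst.
apply: measurable_minr; first exact: measurable_cst.
have qle x k : - (L * `|v|) <= diffquo f v x k <= L * `|v| by rewrite -ler_norml qL.
apply: (@measurable_fun_limn_sup _ _ _ setT (fun k t => diffquo f v (rho t) k)).
- by move=> t _; exists (L * `|v|) => _ [k _ <-]; have /andP[] := qle (rho t) k.
- by move=> t _; exists (- (L * `|v|)) => _ [k _ <-]; have /andP[] := qle (rho t) k.
- exact: mq.
Qed.

Let diffquo_translate_cvg u v x j :
  (fun k : nat => diffquo f u (x - k.+1%:R^-1 *: v) j) @ \oo --> diffquo f u x j.
Proof.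
have K0 : 0 < j.+1%:R * (L + L) by rewrite mulr_gt0 ?addr_gt0.
have := lipschitz_continuous (W := R^o) K0 (fun x y => q_lip u j x y).
move=> /(_ x) cq.
have xx : (fun k : nat => x - k.+1%:R^-1 *: v) @ \oo --> x - 0 *: v.
  by apply: cvgB; [exact: cvg_cst|apply: cvgZr_tmp; exact: cvg_harmonic].
by rewrite scale0r subr0 in xx; exact: (cvg_comp _ _ xx cq).
Qed.

(** [g_ k] is the defect of the [k]-th quotients and [g] its limit. Against a fixed [g_ j],
    summation by parts moves the difference in [g_ k] onto [g_ j], which is continuous; hence
    [g_ j * g] has integral 0. Letting [j] grow, so has [g * g]. *)
Lemma ae_limquoD v w :
  {ae mu, forall t, limquo (v + w) (rho t) = limquo v (rho t) + limquo w (rho t)}.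
Proof.
pose g x := limquo (v + w) x - limquo v x - limquo w x.
pose g_ k x := diffquo f (v + w) x k - diffquo f v x k - diffquo f w x k.
pose C := L * `|v + w| + L * `|v| + L * `|w|.
pose M' := M + `|v| + `|w|.
have M'0 : 0 < M' by rewrite /M' !ltr_wpDr.
have C0 : 0 <= C by rewrite !addr_ge0// mulr_ge0// ltW.
have mg : row_measurable g by do 2 apply: row_measurableB => //.
have mg_ k : row_measurable (g_ k) by do 2 apply: row_measurableB => //.
have gC k x : `|g_ k x| <= C.
  rewrite (le_trans (ler_normB _ _))// lerD//.
  by rewrite (le_trans (ler_normB _ _))// lerD.
have gle x : `|g x| <= C.
  rewrite (le_trans (ler_normB _ _))// lerD//.
  by rewrite (le_trans (ler_normB _ _))// lerD.
have sg_ k : bounded_supp C M' (g_ k).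
  move=> x; split=> // Mx.
  rewrite /g_ (proj2 (qM (v + w) k x)) ?(proj2 (qM v k x)) ?(proj2 (qM w k x)) ?subrr//.
  - by rewrite (le_trans _ Mx)// /M' addrAC lerDl.
  - by rewrite (le_trans _ Mx)// /M' lerDl.
  - by rewrite (le_trans _ Mx)// /M' -addrA lerD2l ler_normD.
have g_g : {ae mu, forall t, g_ ^~ (rho t) @ \oo --> g (rho t)}.
  move: (ae_cvg_diffquo (v + w)) (ae_cvg_diffquo v) (ae_cvg_diffquo w).
  apply: filterS3 => t /limquo_lim q1 /limquo_lim q2 /limquo_lim q3.
  by apply: cvgB => //; apply: cvgB.
(* the second difference is the first difference of a difference quotient *)
have g_E k x : g_ k x = diffquo f w (x + k.+1%:R^-1 *: v) k - diffquo f w x k.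
  rewrite /g_ /diffquo scalerDr addrA; ring.
have gg_ j : row_integral (fun x => g_ j x * g x) = 0%E.
  apply: (@cvg_unique _ _ ((row_integral \o (fun k x => g_ j x * g_ k x)) @ \oo)).
  - exact: ereal_hausdorff.
  - apply: (@bounded_supp_cvg _ _ (C * C) M') => //.
    + by move=> k; exact: row_measurableM.
    + by move=> k; exact: bounded_suppM.
    + exact: row_measurableM.
    + by move: g_g; apply: filterS => t gt; apply: cvgM; [exact: cvg_cst|].
  - have -> : row_integral \o (fun k x => g_ j x * g_ k x) = row_integral \o (fun k x =>
        (g_ j (x - k.+1%:R^-1 *: v) - g_ j x) * diffquo f w x k).
      apply/funext => k /=.
      transitivity (row_integral (fun x =>
        (diffquo f w (x + k.+1%:R^-1 *: v) k - diffquo f w x k) * g_ j x)).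
        by apply: eq_integral => t _; rewrite -g_E mulrC.
      apply: (row_integral_by_parts (C := L * `|w|) (M := M + `|w|) (C' := C)
        (phi := fun x => diffquo f w x k)) => //.
      by rewrite ltr_wpDr.
    have -> : 0%E = row_integral (fun x : 'rV[R]_n => 0) by rewrite /row_integral integral0.
    apply: (@bounded_supp_cvg _ _ ((C + C) * (L * `|w|)) (M + `|w|)).
    + by rewrite ltr_wpDr.
    + move=> k; apply: row_measurableM => //; apply: row_measurableB => //.
      exact: row_measurable_translate.
    + move=> k; apply: bounded_suppM => //; first by rewrite addr_ge0.
      by move=> x; rewrite (le_trans (ler_normB _ _))// lerD.
    + exact: measurable_cst.
      move: (ae_cvg_diffquo w); apply: filterS => t /limquo_lim qw.
      have g0 : (fun k : nat => g_ j (rho t - k.+1%:R^-1 *: v) - g_ j (rho t)) @ \oo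
          --> g_ j (rho t) - g_ j (rho t).
        apply: cvgB; last exact: cvg_cst.
        by apply: cvgB; [apply: cvgB|]; exact: diffquo_translate_cvg.
      by have := cvgM g0 qw; rewrite subrr mul0r; apply.
have : row_integral (fun x => g x * g x) = 0%E.
  apply: (@cvg_unique _ _ ((row_integral \o (fun k x => g_ k x * g x)) @ \oo)).
  - exact: ereal_hausdorff.
  - apply: (@bounded_supp_cvg _ _ (C * C) M') => //.
    + by move=> k; exact: row_measurableM.
    + move=> k x; have [gkC gkM] := sg_ k x; split; last by move=> /gkM ->; rewrite mul0r.
      by rewrite normrM ler_pM// gle.
    + exact: row_measurableM.
    + by move: g_g; apply: filterS => t gt; apply: cvgM; [|exact: cvg_cst].
  - have -> : row_integral \o (fun k x => g_ k x * g x) = fun=> 0%E.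
      by apply/funext => k; exact: gg_.
    exact: cvg_cst.
move=> /(row_integral_sqr_eq0 mg); apply: filterS => t.
by rewrite /g; lra.
Qed.

(** Integer directions are countable, so one null set serves for convergence in all of them and for
    all additivity relations. *)
Lemma rademacher_scalar : {ae mu, forall t, differentiable f (rho t)}.
Proof.
have h1 : {ae mu, forall t, forall z : 'rV[int]_n,
    cvgn (diffquo f (introw z) (rho t))}.
  by apply: ae_forall_countable => z; exact: ae_cvg_diffquo.
have h2 : {ae mu, forall t, forall zw : 'rV[int]_n * 'rV[int]_n,
    limquo (introw zw.1 + introw zw.2) (rho t) =
    limquo (introw zw.1) (rho t) + limquo (introw zw.2) (rho t)}.
  by apply: ae_forall_countable => zw; exact: ae_limquoD.
move: h1 h2; apply: filterS2 => t h1 h2.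
apply: (@lipschitz_integer_differentiable _ _ f L _
  (fun z => limquo (introw z) (rho t))) => //.
- move=> z w; rewrite -(h2 (z, w)) /introw; congr (limquo _ _).
  by apply/rowP => i; rewrite !mxE intrD.
- by move=> z; exact: limquo_lim.
Qed.

End rademacher.

(** * Local facts on differentials, and extension of a locally Lipschitz map *)

Section differentiable_more.
Context {R : realType}.

(** Differentials depend only on the germ; this carries differentiability from the cutoff back to
    the original map. *)
Lemma near_eq_diff {V W : normedModType R} (f g : V -> W) x :
  (\forall y \near x, f y = g y) -> differentiable f x ->
  differentiable g x /\ 'd g x = 'd f x :> (V -> W).
Proof.
move=> fg df; apply: diff_eps; first exact: diff_continuous.
move=> e e0; have fgx : f x = g x := nbhs_singleton fg.
have fg0 : \forall h \near (0 : V), f (x + h) = g (x + h) by exact: (nbhs0P (fun u => f u = g u) x).1.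
move: fg0 (differentiable_eps df e0); apply: filterS2 => h fgh.
by rewrite fgx fgh.
Qed.

Lemma diffquo_cvg {V : normedModType R} (f : V -> R) (v x : V) :
  differentiable f x -> diffquo f v x @ \oo --> 'd f x v.
Proof.
move=> df; apply/cvgrPdist_le => e e0.
have v0 : 0 < `|v| + 1 by rewrite ltr_wpDl.
have ev : 0 < e / (`|v| + 1) by rewrite divr_gt0.
have kv : (fun k : nat => k.+1%:R^-1 *: v) @ \oo --> 0 *: v.
  by apply: cvgZr_tmp; exact: cvg_harmonic.
rewrite scale0r in kv.
have fkv : \forall k \near \oo, `|f (x + k.+1%:R^-1 *: v) - f x -
    'd f x (k.+1%:R^-1 *: v)| <= e / (`|v| + 1) * `|k.+1%:R^-1 *: v|.
  exact: kv _ (differentiable_eps df ev).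
move: fkv; apply: filterS => k fk.
have k0 : 0 < k.+1%:R :> R by [].
rewrite /diffquo distrC.
have -> : k.+1%:R * (f (x + k.+1%:R^-1 *: v) - f x) - 'd f x v =
  k.+1%:R * (f (x + k.+1%:R^-1 *: v) - f x - 'd f x (k.+1%:R^-1 *: v)).
  rewrite [in RHS]linearZ/= [in RHS]mulrBr; congr (_ - _).
  by rewrite [_ *: _]/(_ * _) mulVKf// gt_eqF.
rewrite normrM ger0_norm// mulrC -ler_pdivlMr// (le_trans fk)//.
rewrite normrZ ger0_norm// mulrCA mulrC ler_wpM2r//.
by rewrite mulrAC ler_pdivrMr// ler_wpM2l ?lerDl// ltW.
Qed.

Lemma differentiable_row {V : normedModType R} m (y : V -> 'rV[R]_m) x :
  (forall j, differentiable (fun u => y u ord0 j) x) -> differentiable y x.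
Proof.
move=> dy.
have -> : y = \sum_(j < m) (fun u => y u ord0 j *: delta_mx ord0 j).
  by apply/funext => u; rewrite fct_sumE [LHS]row_sum_delta.
by apply: differentiable_sum => j; exact: differentiableZl.
Qed.

End differentiable_more.

Lemma max0_lip {R : realDomainType} (a b : R) :
  `|Num.max 0 a - Num.max 0 b| <= `|a - b|.
Proof.
have h1 := ler_norm (a - b); have := ler_norm (b - a); rewrite distrC.
move: (`|a - b|) h1 => c h1 h2; rewrite ler_norml.
by case: (leP 0 a) => a0; case: (leP 0 b) => b0; apply/andP; split; lra.
Qed.

Lemma clamp1_lip {R : realDomainType} (r a b : R) :
  `|Num.max (- r) (Num.min r a) - Num.max (- r) (Num.min r b)| <= `|a - b|.
Proof.
have h1 := ler_norm (a - b); have := ler_norm (b - a); rewrite distrC.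
move: (`|a - b|) h1 => c h1 h2; rewrite ler_norml.
case: (leP r a) => a0; case: (leP r b) => b0.
- by case: (leP (- r) r) => ?; apply/andP; split; lra.
- by case: (leP (- r) r) => ?; case: (leP (- r) b) => ?; apply/andP; split; lra.
- by case: (leP (- r) r) => ?; case: (leP (- r) a) => ?; apply/andP; split; lra.
- by case: (leP (- r) b) => ?; case: (leP (- r) a) => ?; apply/andP; split; lra.
Qed.

(* Clamping to a cube extends a local Lipschitz map; the factor chi makes the
   extension compactly supported. *)
Section cutoff.
Context {R : realType} {n m : nat}.
Variables (y : 'rV[R]_n -> 'rV[R]_m) (x0 : 'rV[R]_n) (r L : R).
Hypothesis r_gt0 : 0 < r.
Hypothesis L_gt0 : 0 < L.
Hypothesis yL : forall u v, `|u - x0| <= r -> `|v - x0| <= r ->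
  `|y u - y v| <= L * `|u - v|.

Let clamp (u : 'rV[R]_n) : 'rV[R]_n :=
  \row_i (x0 ord0 i + Num.max (- r) (Num.min r (u ord0 i - x0 ord0 i))).

Let clamp_lip u v : `|clamp u - clamp v| <= `|u - v|.
Proof.
apply: norm_le_coord => // i j; rewrite ord1 (le_trans _ (coord_le_norm _ ord0 j))//.
rewrite !mxE; set a := u _ _; set b := v _ _; set c := x0 _ _.
have -> : c + Num.max (- r) (Num.min r (a - c)) - (c + Num.max (- r) (Num.min r (b - c))) =
  Num.max (- r) (Num.min r (a - c)) - Num.max (- r) (Num.min r (b - c)) by ring.
have -> : a - b = (a - c) - (b - c) by ring.
exact: clamp1_lip.
Qed.

Let clamp_le u : `|clamp u - x0| <= r.
Proof.
apply: norm_le_coord => [|i j]; first exact: ltW.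
have -> : (clamp u - x0) i j = Num.max (- r) (Num.min r (u ord0 j - x0 ord0 j)).
  by rewrite (ord1 i) !mxE addrAC addrN add0r.
rewrite ler_norml.
by rewrite le_max lexx/= ge_max ge_min lexx/= andbT; move: r_gt0; lra.
Qed.

Let clamp_id u : `|u - x0| <= r -> clamp u = u.
Proof.
move=> ur; apply/rowP => i; rewrite !mxE.
have := le_trans (coord_le_norm (u - x0) ord0 i) ur.
rewrite !mxE ler_norml => /andP[u1 u2].
by rewrite min_r// max_r// addrC subrK.
Qed.

(** Equal to 1 on the cube, and to 0 wherever [clamp] moves a point by at least 1. *)
Let chi (u : 'rV[R]_n) : R := Num.max 0 (1 - `|u - clamp u|).

Let chi_lip u v : `|chi u - chi v| <= 2 * `|u - v|.
Proof.
apply: le_trans (max0_lip _ _) _.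
have -> : 1 - `|u - clamp u| - (1 - `|v - clamp v|) = `|v - clamp v| - `|u - clamp u|.
  by ring.
rewrite (le_trans (ler_dist_dist _ _))// opprD opprK addrACA (le_trans (ler_normD _ _))//.
rewrite mulr_natl mulr2n lerD//; first by rewrite distrC.
by rewrite addrC (le_trans (clamp_lip _ _)).
Qed.

Let chi_le u : `|chi u| <= 1.
Proof.
by rewrite ger0_norm /chi ?le_max ?lexx// ge_max ler01/= lerBlDr lerDl.
Qed.

Definition cutoff u := chi u *: y (clamp u).

(** A bound for [y] on the cube, which enters the Lipschitz constant of the product. *)
Let B := `|y x0| + L * r.

Lemma cutoff_id u : `|u - x0| <= r -> cutoff u = y u.
Proof.
move=> ur; have cu := clamp_id ur; rewrite /cutoff.
have -> : chi u = 1 by rewrite /chi cu addrN normr0 subr0 max_r.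
by rewrite scale1r cu.
Qed.

(** Product rule: [chi] is 2-Lipschitz with values in [[0, 1]], and [y] after clamping is bounded by
    [B] and [L]-Lipschitz. *)
Lemma cutoff_lip u v : `|cutoff u - cutoff v| <= (2 * B + L) * `|u - v|.
Proof.
have yB : `|y (clamp u)| <= B.
  rewrite -(subrK (y x0) (y (clamp u))) addrC (le_trans (ler_normD _ _))// lerD2l.
  rewrite (le_trans (yL _ _))//; first by rewrite subrr normr0 ltW.
  by rewrite ler_wpM2l// ltW.
have -> : cutoff u - cutoff v =
    (chi u - chi v) *: y (clamp u) + chi v *: (y (clamp u) - y (clamp v)).
  by rewrite scalerBl scalerBr addrA subrK.
rewrite mulrDl (le_trans (ler_normD _ _))// !normrZ lerD//.
  by rewrite mulrAC ler_pM.
rewrite -[leRHS]mul1r ler_pM// (le_trans (yL _ _))//.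
by rewrite ler_wpM2l// ltW.
Qed.

Lemma cutoff_supp u : `|x0| + r + 1 <= `|u| -> cutoff u = 0.
Proof.
move=> uM; rewrite /cutoff /chi max_l ?scale0r// subr_le0.
have := ler_normD (u - clamp u) (clamp u); rewrite subrK => uc.
have := ler_normD (clamp u - x0) x0; rewrite subrK => cx.
by have := clamp_le u; move: uM uc cx; lra.
Qed.

End cutoff.

(** * Rademacher's theorem for maps, and a mean value inequality *)

Section mean_value.
Context {R : realType} {n m : nat}.
Local Notation mu := (lebesgue_tuple R n).
Local Notation rho := (@row_of_tuple R n).

Lemma rademacher (F : 'rV[R]_n -> 'rV[R]_m) (L M : R) : 0 < L -> 0 < M ->
  (forall u v, `|F u - F v| <= L * `|u - v|) ->
  (forall u, M <= `|u| -> F u = 0) ->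
  {ae mu, forall t, differentiable F (rho t)}.
Proof.
move=> L0 M0 FL FM.
have : {ae mu, forall t, forall j, differentiable (fun u => F u ord0 j) (rho t)}.
  apply: ae_forall_countable => j; apply: (@rademacher_scalar _ _ _ L M) => //.
    move=> u v; apply: le_trans (FL u v).
    by rewrite (le_trans _ (coord_le_norm _ ord0 j))// !mxE.
  by move=> u /FM ->; rewrite mxE.
by apply: filterS => t; exact: differentiable_row.
Qed.

(** Balls have positive measure, so none lies inside a null set. *)
Lemma ae_exists_near (P : 'rV[R]_n -> Prop) (Q : n.-tuple (measurableTypeR R) -> Prop)
    (u : 'rV[R]_n) :
  {ae mu, forall t, Q t} -> (\forall v \near u, P v) ->
  exists t, Q t /\ P (rho t).
Proof.
move=> [A [mA A0 QA]] /nbhs_ballP[e /= e0 eP].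
apply: contrapT => nPQ.
have eA : rho @^-1` ball u e `<=` A.
  by move=> t ut; apply: QA => /= Qt; apply: nPQ; exists t; split => //; exact: eP.
have : (mu (rho @^-1` ball u e) <= mu A)%E.
  by apply: le_measure; rewrite ?inE//; exact: measurable_row_of_tuple_ball.
rewrite lebesgue_tuple_ball// [X in (_ <= X)%E]A0.
by rewrite lee_fin leNgt exprn_gt0// mulrn_wgt0.
Qed.

Lemma differentiable_pairing (F : 'rV[R]_n -> 'rV[R]_m) (c : 'cV[R]_m) x :
  differentiable F x -> differentiable (fun u => pairing c (F u)) x /\
    forall h, 'd (fun u => pairing c (F u)) x h = pairing c ('d F x h).
Proof.
move=> dF.
have dp : differentiable (pairing c) (F x).
  by apply: linear_differentiable; exact: pairing_continuous.
split; first exact: differentiable_comp.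
move=> h; rewrite (diff_comp dF dp)/= diff_lin//; exact: pairing_continuous.
Qed.

Lemma near_norm_lt (x0 v : 'rV[R]_n) r : `|v - x0| < r ->
  \forall w \near v, `|w - x0| < r.
Proof.
move=> vr; apply/nbhs_ballP; exists (r - `|v - x0|); first by rewrite /= subr_gt0.
move=> w; rewrite -ball_normE /= ltrBrDr => /(le_lt_trans _); apply.
by rewrite (distrC v) -{1}(subrK v w) -addrA ler_normD.
Qed.

(** The given segment may lie inside the non-differentiability set, but the strict inequality
    survives a move to a nearby parallel segment that meets this set in a null set. *)
Lemma lipschitz_mvt (y : 'rV[R]_n -> 'rV[R]_m) (x0 : 'rV[R]_n) (r L : R)
    (c : 'cV[R]_m) (u d : 'rV[R]_n) (a : R) : 0 < r -> 0 < L ->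
  (forall v w, `|v - x0| <= r -> `|w - x0| <= r -> `|y v - y w| <= L * `|v - w|) ->
  `|u - x0| < r -> `|u + d - x0| < r ->
  a < pairing c (y (u + d) - y u) ->
  exists v, [/\ `|v - x0| < r, differentiable y v & a <= pairing c ('d y v d)].
Proof.
move=> r0 L0 yL ur udr ay.
pose F := cutoff y x0 r.
pose K := 2 * (`|y x0| + L * r) + L.
have K0 : 0 < K by rewrite ltr_wpDl// mulr_ge0// addr_ge0// mulr_ge0// ltW.
have FK : forall u v, `|F u - F v| <= K * `|u - v| by exact: cutoff_lip.
have aeF := rademacher K0 _ FK (cutoff_supp _ r0).
have [//|A [mA A0 FA]] := aeF; first by rewrite ltr_wpDl// addr_ge0// ltW.
have aeline := null_ae_lines d mA A0.
(* All three conditions are open in the base point, so they hold at some point [rho t] with [t] in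
   the set of full measure. *)
have near_u : \forall v \near u, [/\ `|v - x0| < r, `|v + d - x0| < r &
    a < pairing c (F (v + d) - F v)].
  have cF := lipschitz_continuous K0 FK.
  have cp : pairing c (F (v + d) - F v) @[v --> u] --> pairing c (F (u + d) - F u).
    have c1 : F (v + d) @[v --> u] --> F (u + d).
      have c0 : continuous (fun v : 'rV[R]_n => v + d).
        apply: (lipschitz_continuous ltr01) => v w.
        by rewrite mul1r opprD addrACA addrN addr0.
      exact: (cvg_comp _ _ (c0 u) (cF (u + d))).
    exact: (cvg_comp _ _ (cvgB c1 (cF u)) (@pairing_continuous _ _ c _)).
  near=> v; split; near: v.
  - exact: near_norm_lt.
  - have ud : `|u - (x0 - d)| < r by rewrite opprB addrA.
    by move: (near_norm_lt ud); apply: filterS => v; rewrite opprB addrA.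
  - apply: (cvgr_gt _ cp); rewrite /F !cutoff_id//; exact: ltW.
have [t [tA [tr tdr at_]]] := ae_exists_near aeline near_u.
apply: contrapT => nex.
pose p v := pairing c (F v).
pose h (s : R) := p (rho t + s *: d).
(* By convexity the segment stays in the ball where the extension agrees with [y]. *)
have hr s : `]0, 1[%classic s -> `|rho t + s *: d - x0| < r.
  rewrite /= in_itv/= => /andP[s0 s1].
  have -> : rho t + s *: d - x0 = (1 - s) *: (rho t - x0) + s *: (rho t + d - x0).
    by apply/rowP => i; rewrite !mxE; ring.
  have s10 : 0 < 1 - s by rewrite subr_gt0.
  rewrite (le_lt_trans (ler_normD _ _))// !normrZ !gtr0_norm//.
  have -> : r = (1 - s) * r + s * r by ring.
  by rewrite ltrD// ltr_pM2l.
pose Lh := m%:R * `|c| * K * `|d| + 1.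
have Lh0 : 0 < Lh by rewrite ltr_wpDl// !mulr_ge0// ltW.
have hL s s' : `|h s - h s'| <= Lh * `|s - s'|.
  rewrite /h /p -raddfB (le_trans (pairing_le _ _))//.
  rewrite (le_trans (ler_wpM2l _ (FK _ _)))// ?mulr_ge0//.
  rewrite opprD addrACA addrN add0r -scalerBl normrZ /Lh [leRHS]mulrDl mul1r.
  have -> : m%:R * `|c| * (K * (`|s - s'| * `|d|)) = m%:R * `|c| * K * `|d| * `|s - s'| by ring.
  by rewrite lerDl.
(* If no point qualified, the derivative along the segment would be below [a] almost everywhere,
   against the strict inequality between its ends. *)
have : h 1 - h 0 <= a.
  apply: (lipschitz1_ae_le Lh0 hL).
  move: tA => [B [mB B0 AB]]; exists B; split => // s /= /not_implyP[s01 /negP].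
  rewrite -ltNge => as_; apply: AB; split => //=; apply: contrapT => nA.
  apply: nex; exists (rho t + s *: d).
  have dF : differentiable F (rho t + s *: d).
    by apply: contrapT => ndF; apply: nA; apply: FA; rewrite /= row_of_translate.
  have Fy : \forall w \near (rho t + s *: d), F w = y w.
    move: (near_norm_lt (hr _ s01)); apply: filterS => w wr.
    by apply: cutoff_id; exact: ltW.
  have [dy dyE] := near_eq_diff Fy dF.
  split; [exact: hr|exact: dy|].
  have [dp dpE] := differentiable_pairing c dF.
  rewrite dyE -dpE; move: as_.
  have -> : diffquo (h : R^o -> R) 1 s = diffquo p d (rho t + s *: d).
    by apply/funext => k; exact: diffquo_line.
  have dlim : limn (diffquo p d (rho t + s *: d)) = 'd p (rho t + s *: d) d.
    exact: (cvg_lim (@Rhausdorff R) (@diffquo_cvg _ _ p d _ dp)).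
  by rewrite [limn _]dlim => /ltW.
apply/negP; rewrite -ltNge /h /p scale1r scale0r addr0 -raddfB//.
Unshelve. all: by end_near. Qed.

End mean_value.

(** * Convex hulls: Caratheodory's theorem, compactness and separation *)

Section convexity.
Context {R : realType}.

Lemma convex_setE (E : lmodType R) (A : set E) : @convex_set R E A <->
  forall x y (t : R), A x -> A y -> 0 <= t -> t <= 1 -> A (t *: x + (1 - t) *: y).
Proof.
split=> [cA x y t Ax Ay t0 t1|cA x y t].
  by have := cA x y (Itv01 t0 t1); rewrite !inE; exact.
rewrite !inE => Ax Ay; apply: (cA x y t%:num) => //.
Qed.

Lemma sub_convex_hull (E : lmodType R) (A : set E) : A `<=` convex_hull A.
Proof. exact: sub_smallest. Qed.

Lemma convex_hull_sub (E : lmodType R) (A C : set E) :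
  @convex_set R E C -> A `<=` C -> convex_hull A `<=` C.
Proof. by move=> cC AC; exact: smallest_sub. Qed.

Lemma convex_hull_convex (E : lmodType R) (A : set E) :
  @convex_set R E (convex_hull A).
Proof.
apply/convex_setE => x y t Ax Ay t0 t1 C [cC AC].
by have /convex_setE := cC; apply => //; [exact: Ax|exact: Ay].
Qed.

Definition combinations (E : lmodType R) (A : set E) k : set E :=
  [set x | exists a : 'I_k -> E, exists l : 'I_k -> R,
    [/\ forall i, A (a i), forall i, 0 <= l i, \sum_i l i = 1 &
        x = \sum_i l i *: a i]].

Lemma combinations_conv (E : lmodType R) (A : set E) k k' x y t :
  combinations A k x -> combinations A k' y -> 0 <= t -> t <= 1 ->
  combinations A (k + k') (t *: x + (1 - t) *: y).
Proof.
move=> [a [l [Aa l0 l1 ->]]] [b [l' [Ab l'0 l'1 ->]]] t0 t1.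
exists (fun i => match fintype.split i with inl j => a j | inr j => b j end).
exists (fun i => match fintype.split i with inl j => t * l j | inr j => (1 - t) * l' j end).
split.
- by move=> i; case: (fintype.split i).
- by move=> i; case: (fintype.split i) => j; rewrite mulr_ge0// subr_ge0.
- rewrite big_split_ord/= (eq_bigr (fun i => t * l i)); last first.
    by move=> i _; rewrite (unsplitK (inl _ i)).
  rewrite (eq_bigr (fun i => (1 - t) * l' i)); last first.
    by move=> i _; rewrite (unsplitK (inr _ i)).
  by rewrite -!mulr_sumr l1 l'1 !mulr1 addrC subrK.
- rewrite big_split_ord/= !scaler_sumr; congr (_ + _); apply: eq_bigr => i _.
    by rewrite (unsplitK (inl _ i)) scalerA.
  by rewrite (unsplitK (inr _ i)) scalerA.
Qed.

(* An affine dependence between the points lets one weight be driven to zero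
   while the others stay nonnegative. *)
Lemma combinations_reduce n (A : set 'rV[R]_n) k : (n < k)%N ->
  combinations A k.+1 `<=` combinations A k.
Proof.
move=> nk x [a [l [Aa l0 l1 xE]]].
(* The column of ones forces a kernel vector to have zero sum; one exists because the [k + 1] rows
   outnumber the [n + 1] columns. *)
pose M : 'M[R]_(k.+1, n + 1) := \matrix_i row_mx (a i) 1%:M.
have [w /sub_kermxP wM w0] : exists2 w : 'rV_k.+1, (w <= kermx M)%MS & w != 0.
  apply/rowV0Pn; rewrite -mxrank_eq0 mxrank_ker subn_eq0 -ltnNge.
  by rewrite (leq_ltn_trans (rank_leq_col _))// addn1 ltnS.
have wa : \sum_i w ord0 i *: a i = 0.
  have /(congr1 lsubmx) := wM; rewrite linear0 mulmx_sum_row linear_sum/= => e.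
  rewrite -[RHS]e; apply: eq_bigr => i _; rewrite linearZ/= rowK row_mxKl//.
have w1 : \sum_i w ord0 i = 0.
  have /(congr1 rsubmx) := wM; rewrite linear0 mulmx_sum_row linear_sum/=.
  move=> /matrixP/(_ ord0 ord0); rewrite summxE mxE => e.
  by rewrite -[RHS]e; apply: eq_bigr => i _; rewrite linearZ/= rowK row_mxKr !mxE eqxx mulr1.
have [i1 wi1] : exists i, 0 < w ord0 i.
  apply: contrapT => nw; case/eqP: w0; apply/rowP => i; rewrite mxE.
  have wle j : w ord0 j <= 0 by rewrite leNgt; apply/negP => wj; apply: nw; exists j.
  have /eqP := w1; rewrite -oppr_eq0 -sumrN psumr_eq0 => [|j _]; last by rewrite oppr_ge0.
  by move=> /allP/(_ i); rewrite mem_index_enum oppr_eq0 => /(_ isT)/eqP.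
(* The smallest ratio is the largest step [tau] along [w] that keeps all weights nonnegative, and it
   cancels the weight at [i0]. *)
pose i0 := [arg min_(i < i1 | 0 < w ord0 i) (l i / w ord0 i)]%O.
have [wi0 mini0] : 0 < w ord0 i0 /\ forall j, 0 < w ord0 j -> l i0 / w ord0 i0 <= l j / w ord0 j.
  by rewrite /i0; case: arg_minP.
pose tau := l i0 / w ord0 i0.
pose l' i := l i - tau * w ord0 i.
have tau0 : 0 <= tau by rewrite divr_ge0// ltW.
have l'i0 : l' i0 = 0 by rewrite /l' /tau divfK ?subrr// gt_eqF.
have l'0 i : 0 <= l' i.
  rewrite subr_ge0; have [wi|wi] := leP (w ord0 i) 0.
    by rewrite (le_trans _ (l0 i))// mulr_ge0_le0.
  by rewrite -ler_pdivlMr// mini0.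
exists (fun j => a (lift i0 j)), (fun j => l' (lift i0 j)); split => //.
- have : \sum_i l' i = 1 by rewrite sumrB -mulr_sumr w1 mulr0 subr0.
  by rewrite (bigD1_ord i0)//= l'i0 add0r.
- have : \sum_i l' i *: a i = x.
    under eq_bigr do rewrite scalerBl -scalerA.
    by rewrite sumrB -scaler_sumr wa scaler0 subr0.
  by rewrite (bigD1_ord i0)//= l'i0 scale0r add0r.
Qed.

(** Caratheodory's theorem. Combinations of [n + 1] points form a convex set: mixing two of them
    uses [2n + 2] points, and the surplus is removed one by one. *)
Lemma convex_hull_combinations n (A : set 'rV[R]_n) :
  convex_hull A `<=` combinations A n.+1.
Proof.
apply: convex_hull_sub.
  have red k : combinations A (n.+1 + k) `<=` combinations A n.+1.
    elim: k => [|k IH]; first by rewrite addn0.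
    rewrite addnS; apply: subset_trans IH; apply: combinations_reduce.
    by rewrite leq_addr.
  by apply/convex_setE => x y t Ax Ay t0 t1; apply: (red n.+1); exact: combinations_conv.
move=> x Ax; exists (fun=> x), (fun i => (i == ord0)%:R); split=> //.
  by rewrite (bigD1 ord0)//= big1 ?addr0// => i /negPf ->.
by rewrite (bigD1 ord0)//= big1 ?addr0 ?scale1r// => i /negPf ->; rewrite scale0r.
Qed.

(** Each iterate is a continuous image of the product of [[0, 1]], [A] and the previous iterate, so
    compactness passes along without a simplex of weights. *)
Fixpoint join_iter n (A : set 'rV[R]_n) k : set 'rV[R]_n :=
  if k is k'.+1 then
    (fun z : R * ('rV[R]_n * 'rV[R]_n) => z.1 *: z.2.1 + (1 - z.1) *: z.2.2) @`
      (`[0, 1] `*` (A `*` join_iter A k'))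
  else A.

Lemma join_iter_compact n (A : set 'rV[R]_n) k : compact A ->
  compact (join_iter A k).
Proof.
move=> cA; elim: k => //= k IH.
apply: continuous_compact; last first.
  by apply: compact_setX; [exact: segment_compact|exact: compact_setX].
apply: continuous_subspaceT => z.
have c1 : {for z, continuous (fun z : R * ('rV[R]_n * 'rV[R]_n) => z.1)} by exact: cvg_fst.
have c2 : {for z, continuous (fun z : R * ('rV[R]_n * 'rV[R]_n) => z.2.1)}.
  by apply: continuous_comp; [exact: cvg_snd|exact: cvg_fst].
have c3 : {for z, continuous (fun z : R * ('rV[R]_n * 'rV[R]_n) => z.2.2)}.
  by apply: continuous_comp; [exact: cvg_snd|exact: cvg_snd].
apply: cvgD; apply: cvgZ => //.
by apply: cvgB => //; exact: cvg_cst.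
Qed.

Lemma sub_join_iter n (A : set 'rV[R]_n) k : A `<=` join_iter A k.
Proof.
elim: k => //= k IH x Ax; exists (1, (x, x)) => /=.
  by split=> //=; [rewrite in_itv/= ler01 lexx|split => //; exact: IH].
by rewrite subrr scale1r scale0r addr0.
Qed.

Lemma join_iter_sub n (A : set 'rV[R]_n) k : join_iter A k `<=` convex_hull A.
Proof.
elim: k => [|k IH] /=; first exact: sub_convex_hull.
move=> _ [[t [a s]] /= [t01 [Aa /IH hs]] <-].
move: t01; rewrite in_itv/= => /andP[t0 t1].
have /convex_setE := @convex_hull_convex _ A; apply=> //.
exact: sub_convex_hull.
Qed.

(** The first weight is split off and the others are divided by their sum [s]; when [s = 0] the
    point already lies in [A]. *)
Lemma combinations_join_iter n (A : set 'rV[R]_n) k :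
  combinations A k.+1 `<=` join_iter A k.
Proof.
elim: k => [|k IH] x [a [l [Aa l0 l1 ->]]].
  by move: l1; rewrite !big_ord1 => ->; rewrite scale1r.
move: l1; rewrite big_ord_recl [in X in _ -> X]big_ord_recl => l1.
set s := \sum_(i < k.+1) l (lift ord0 i) in l1.
have s0 : 0 <= s by exact: sumr_ge0.
have [s00|sn0] := eqVneq s 0.
  have li i : l (lift ord0 i) = 0.
    have /eqP := s00; rewrite psumr_eq0 => [|j _//].
    by move=> /allP/(_ i); rewrite mem_index_enum => /(_ isT)/eqP.
  rewrite big1 => [|i _]; last by rewrite li scale0r.
  rewrite s00 addr0 in l1.
  by rewrite addr0 l1 scale1r; exact: sub_join_iter.
have lE : 1 - l ord0 = s by rewrite -l1 addrC addKr.
exists (l ord0, (a ord0, \sum_i (l (lift ord0 i) / s) *: a (lift ord0 i))) => /=.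
  split=> /=; first by rewrite in_itv/= l0 -subr_ge0 lE.
  split => //; apply: IH.
  exists (fun i => a (lift ord0 i)), (fun i => l (lift ord0 i) / s); split=> //.
    by move=> i; rewrite divr_ge0.
  by rewrite -mulr_suml mulfV.
congr (_ + _); rewrite lE scaler_sumr; apply: eq_bigr => i _.
by rewrite scalerA mulrCA mulfV// mulr1.
Qed.

(** Caratheodory's bound makes the hull equal to the iterate [join_iter A n]. *)
Lemma convex_hull_compact n (A : set 'rV[R]_n) : compact A ->
  compact (convex_hull A).
Proof.
move=> cA; suff -> : convex_hull A = join_iter A n by exact: join_iter_compact.
apply/seteqP; split; last exact: join_iter_sub.
exact: subset_trans (@convex_hull_combinations _ A) (@combinations_join_iter _ A n).
Qed.

Definition dot n (u v : 'rV[R]_n) : R := pairing v^T u.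

Lemma dotE n (u v : 'rV[R]_n) : dot u v = \sum_i u ord0 i * v ord0 i.
Proof. by rewrite /dot /pairing mxE; apply: eq_bigr => i _; rewrite mxE. Qed.

Lemma dotC n (u v : 'rV[R]_n) : dot u v = dot v u.
Proof. by rewrite !dotE; apply: eq_bigr => i _; rewrite mulrC. Qed.

Lemma dotDl n (u v w : 'rV[R]_n) : dot (u + v) w = dot u w + dot v w.
Proof. by rewrite /dot raddfD. Qed.

Lemma dotBl n (u v w : 'rV[R]_n) : dot (u - v) w = dot u w - dot v w.
Proof. by rewrite /dot raddfB. Qed.

Lemma dotZl n t (u w : 'rV[R]_n) : dot (t *: u) w = t * dot u w.
Proof. by rewrite /dot linearZ. Qed.

Lemma dot_ge0 n (u : 'rV[R]_n) : 0 <= dot u u.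
Proof. by rewrite dotE sumr_ge0// => i _; rewrite -expr2 sqr_ge0. Qed.

Lemma dot_eq0 n (u : 'rV[R]_n) : dot u u = 0 -> u = 0.
Proof.
rewrite dotE => /eqP; rewrite psumr_eq0 => [/allP u0|i _]; last by rewrite -expr2 sqr_ge0.
apply/rowP => i; rewrite mxE; have := u0 i; rewrite mem_index_enum => /(_ isT).
by rewrite -expr2 sqrf_eq0 => /eqP.
Qed.

Lemma dot_sqrB n t (u v : 'rV[R]_n) :
  dot (t *: u - v) (t *: u - v) = t ^+ 2 * dot u u - 2 * t * dot u v + dot v v.
Proof.
rewrite dotBl dotZl (dotC u) (dotC v) !dotBl !dotZl (dotC v u).
ring.
Qed.

Lemma dot_sqr_continuous n (b : 'rV[R]_n) :
  continuous (fun w : 'rV[R]_n => dot (w - b) (w - b)).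
Proof.
have -> : (fun w : 'rV[R]_n => dot (w - b) (w - b)) =
    fun w => \sum_i (w ord0 i - b ord0 i) * (w ord0 i - b ord0 i).
  by apply/funext => w; rewrite dotE; apply: eq_bigr => i _; rewrite !mxE.
apply: continuous_big => [|i _ w]; first exact: add_continuous.
have cw := cvgB (@coord_continuous R 1 n ord0 i w) (cvg_cst (b ord0 i)).
have FF : Filter (nbhs w) by exact: nbhs_filter.
exact: (cvgM (cw FF FF) (cw FF FF)).
Qed.

(* The nearest point of the compact set separates. *)
Lemma convex_compact_separation n (K : set 'rV[R]_n) b : compact K ->
  @convex_set R 'rV[R]_n K ->
  (forall d, exists2 w, K w & dot b d <= dot w d) -> K b.
Proof.
move=> cK /convex_setE convK Kd.
have K0 : K !=set0 by have [w Kw _] := Kd 0; exists w.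
have [w0] := EVT_min_rV K0 cK (continuous_subspaceT (@dot_sqr_continuous _ b)).
rewrite inE => Kw0 w0min.
(* [w0] is nearest to [b]; testing the hypothesis in direction [b - w0] yields [w] with [D <= G]. *)
have [w Kw] := Kd (b - w0).
pose D := dot (b - w0) (b - w0); pose G := dot (w - w0) (b - w0); pose E := dot (w - w0) (w - w0).
rewrite -subr_ge0 -dotBl => wb.
have DG : D <= G by rewrite -subr_ge0 /D /G -dotBl opprB addrA subrK.
have E0 : 0 <= E by exact: dot_ge0.
(* Minimality of [w0] against the points of the segment from [w0] to [w]. *)
have key t : 0 <= t -> t <= 1 -> 2 * t * G <= t ^+ 2 * E.
  move=> t0 t1; have := w0min (t *: w + (1 - t) *: w0).
  rewrite inE => /(_ (convK _ _ _ Kw Kw0 t0 t1)).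
  have -> : t *: w + (1 - t) *: w0 - b = t *: (w - w0) - (b - w0).
    by apply/rowP => i; rewrite !mxE; ring.
  have -> : w0 - b = 0 *: (w - w0) - (b - w0) by rewrite scale0r sub0r opprB.
  rewrite !dot_sqrB -/D -/G -/E; lra.
have D0 : 0 <= D by exact: dot_ge0.
suff Dle : D <= 0.
  have /dot_eq0 : D = 0 by apply/le_anti; rewrite Dle D0.
  by move=> /subr0_eq ->.
rewrite leNgt; apply/negP => Dgt0.
have DE : 0 < D + E by rewrite ltr_wpDr.
(* With this value of [t], [2 G <= t E = D - t D], which contradicts [0 < D <= G]. *)
have t0 : 0 < D / (D + E) by rewrite divr_gt0.
have := key (D / (D + E)) (ltW t0).
rewrite ler_pdivrMr// mul1r lerDl => /(_ E0).
set t := D / (D + E) in t0 *.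
have tE : t * (D + E) = D by rewrite divfK// gt_eqF.
move=> k; have k2 : 2 * G <= t * E by rewrite -(ler_pM2l t0); move: k; lra.
have tD : 0 < t * D by rewrite mulr_gt0.
by move: tE; rewrite mulrDr; lra.
Qed.

End convexity.

(** * Gradients, the smooth chain rule and strict differentiability *)

Section gradients.
Context {R : realType}.

Lemma dot_le n (u v : 'rV[R]_n) : `|dot u v| <= n%:R * `|u| * `|v|.
Proof.
rewrite dotE (le_trans (ler_norm_sum _ _ _))//.
apply: (@le_trans _ _ (\sum_(k < n) `|u| * `|v|)).
  by apply: ler_sum => k _; rewrite normrM ler_pM// coord_le_norm.
by rewrite sumr_const card_ord -mulrA mulr_natl.
Qed.

Lemma dotBr n (u v w : 'rV[R]_n) : dot u (v - w) = dot u v - dot u w.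
Proof. by rewrite dotC dotBl !(dotC u). Qed.

Lemma dotDr n (u v w : 'rV[R]_n) : dot u (v + w) = dot u v + dot u w.
Proof. by rewrite dotC dotDl !(dotC u). Qed.

Lemma dot_continuous n (d : 'rV[R]_n) : continuous (dot d).
Proof.
apply: (@lipschitz_continuous _ _ _ _ (n%:R * `|d| + 1)).
  by rewrite ltr_wpDl// mulr_ge0.
move=> u v; rewrite -dotBr mulrDl mul1r (le_trans (dot_le _ _))//.
by rewrite lerDl.
Qed.

Lemma segment_norm_lt n (x0 x x' : 'rV[R]_n) s del : 0 < s -> s < 1 ->
  `|x - x0| < del -> `|x' - x0| < del -> `|x + s *: (x' - x) - x0| < del.
Proof.
move=> s0 s1 xd x'd.
have -> : x + s *: (x' - x) - x0 = (1 - s) *: (x - x0) + s *: (x' - x0).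
  by apply/rowP => i; rewrite !mxE; ring.
have s10 : 0 < 1 - s by rewrite subr_gt0.
rewrite (le_lt_trans (ler_normD _ _))// !normrZ !gtr0_norm//.
have -> : del = (1 - s) * del + s * del by ring.
by rewrite ltrD// ltr_pM2l.
Qed.

Lemma dot_delta n (i : 'I_n) (v : 'rV[R]_n) : dot (delta_mx ord0 i) v = v ord0 i.
Proof.
rewrite dotE (bigD1 i)//= big1 ?addr0 => [|j ji]; first by rewrite mxE !eqxx mul1r.
by rewrite mxE (negPf ji) andbF mul0r.
Qed.

Lemma diff_grad n (f : 'rV[R]_n -> R) x h : 'd f x h = dot h (grad f x).
Proof.
rewrite [in LHS](row_sum_delta h) linear_sum dotE; apply: eq_bigr => i _.
by rewrite linearZ mxE.
Qed.

(** In row notation [b *m jac F x] is the transposed Jacobian applied to [b]. *)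
Lemma dot_diff_jac n m (F : 'rV[R]_n -> 'rV[R]_m) x h (b : 'rV[R]_m) :
  dot ('d F x h) b = dot h (b *m jac F x).
Proof.
rewrite /dot /pairing trmx_mul /jac trmxK mulmxA; congr ((_ *m _) _ _).
by rewrite /jacobian mul_rV_lin1.
Qed.

Section product.
Variables (n m : nat) (phi : 'rV[R]_n * 'rV[R]_m -> R).

Lemma diff_partial z a b : differentiable phi z ->
  'd phi z (a, b) = dot a (grad1 phi z.1 z.2) + dot b (grad2 phi z.1 z.2).
Proof.
case: z => x y /= dphi.
have -> : (a, b) = (a, 0) + (0, b) :> 'rV[R]_n * 'rV[R]_m.
  by rewrite -[RHS]/(a + 0, 0 + b) addr0 add0r.
rewrite linearD; congr (_ + _).
  rewrite /grad1 -diff_grad.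
  have d1 : is_diff x (fun u : 'rV[R]_n => (u, y)) (fun u => (u, 0)).
    by have := is_diff_pair (is_diff_id x) (is_diff_cst y x).
  have := @is_diff_comp _ _ _ _ (fun u => (u, y)) _ phi _ x d1 (differentiableP dphi).
  by move=> [_ ->].
rewrite /grad2 -diff_grad.
have d1 : is_diff y (fun v : 'rV[R]_m => (x, v)) (fun v => (0, v)).
  by have := is_diff_pair (is_diff_cst x y) (is_diff_id y).
have := @is_diff_comp _ _ _ _ (fun v => (x, v)) _ phi _ y d1 (differentiableP dphi).
by move=> [_ ->].
Qed.

Lemma grad_comp (y : 'rV[R]_n -> 'rV[R]_m) u :
  differentiable phi (u, y u) -> differentiable y u ->
  differentiable (fun v => phi (v, y v)) u /\
  grad (fun v => phi (v, y v)) u =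
    grad1 phi u (y u) + grad2 phi u (y u) *m jac y u.
Proof.
move=> dphi dy.
have d1 := is_diff_pair (is_diff_id u) (differentiableP dy).
have [d2 dE] := @is_diff_comp _ _ _ _ (fun v => (v, y v)) _ phi _ u d1 (differentiableP dphi).
split; first exact: d2.
apply/rowP => i; rewrite mxE dE /=.
by rewrite diff_partial// dot_diff_jac !dot_delta [RHS]mxE.
Qed.

(** The mean value theorem on the segment between the two points gives an exact formula with partial
    gradients at an intermediate point, which continuity keeps close to those at [(x0, y0)]. *)
Lemma C1_strict_diff x0 y0 e : C1 phi -> 0 < e -> exists2 del, 0 < del &
  forall x x' y y', `|x - x0| < del -> `|x' - x0| < del ->
    `|y - y0| < del -> `|y' - y0| < del ->
    `|phi (x', y') - phi (x, y) -
      (dot (x' - x) (grad1 phi x0 y0) + dot (y' - y) (grad2 phi x0 y0))| <=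
    e * (`|x' - x| + `|y' - y|).
Proof.
move=> [dphi c1 c2] e0.
(* The divisor [n + m + 1] absorbs the dimension factors of [dot_le]. *)
pose e' := e / (n + m).+1%:R.
have e'0 : 0 < e' by rewrite divr_gt0.
have en : n%:R * e' <= e.
  by rewrite mulrCA ler_piMr ?(ltW e0)// ler_pdivrMr// mul1r ler_nat ltnW// ltnS leq_addr.
have em : m%:R * e' <= e.
  by rewrite mulrCA ler_piMr ?(ltW e0)// ler_pdivrMr// mul1r ler_nat ltnW// ltnS leq_addl.
have aux k a g : 0 <= k -> 0 <= a -> g <= e' -> k * e' <= e -> k * a * g <= e * a.
  by move=> k0 a0 ge ke; rewrite mulrAC ler_wpM2r// (le_trans _ ke)// ler_wpM2l.
pose z0 : 'rV[R]_n * 'rV[R]_m := (x0, y0).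
have g1 : \forall z \near z0, `|grad1 phi x0 y0 - grad1 phi z.1 z.2| <= e'.
  by have /cvgrPdist_le/(_ e' e'0) := c1 z0.
have g2 : \forall z \near z0, `|grad2 phi x0 y0 - grad2 phi z.1 z.2| <= e'.
  by have /cvgrPdist_le/(_ e' e'0) := c2 z0.
have gg : \forall z \near z0, `|grad1 phi x0 y0 - grad1 phi z.1 z.2| <= e' /\
    `|grad2 phi x0 y0 - grad2 phi z.1 z.2| <= e' by exact: filterI.
have /nbhs_ballP[del /= del0 Hdel] := gg.
exists del => // x x' y y' xd x'd yd y'd.
pose z : 'rV[R]_n * 'rV[R]_m := (x, y).
pose w : 'rV[R]_n * 'rV[R]_m := (x' - x, y' - y).
pose h (s : R) := phi (z + s *: w).
have dh (s : R) : is_derive s 1 h ('d phi (z + s *: w) w).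
  have d1 := is_diffD (is_diff_cst z s) (is_diff_scalel s w).
  have [d2 dE] := @is_diff_comp _ _ _ _ _ _ phi _ s d1 (differentiableP (dphi _)).
  split; first exact: diff_derivable.
  rewrite deriveE// dE /=.
  congr ('d phi _ _); rewrite -[LHS]/(0 + 1 *: w) add0r scale1r//.
have ch : {within `[0, 1], continuous h}.
  apply: continuous_subspaceT => s; apply: differentiable_continuous.
  by apply/derivable1_diffP; by have [] := dh s.
have [s] := MVT ltr01 (fun s _ => dh s) ch.
rewrite in_itv/= subr0 mulr1 => /andP[s0 s1].
have -> : h 1 = phi (x', y').
  by rewrite /h scale1r; congr phi; rewrite -[LHS]/(x + (x' - x), y + (y' - y)) !subrKC.
have -> : h 0 = phi (x, y) by rewrite /h scale0r addr0.
move=> ->.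
rewrite diff_partial// (_ : z + s *: w = (x + s *: (x' - x), y + s *: (y' - y)))//=.
set zs := (x + s *: (x' - x)); set ys := (y + s *: (y' - y)).
have [|gs1' gs2'] := Hdel (zs, ys).
  split; rewrite -ball_normE /=.
    by rewrite distrC; exact: segment_norm_lt.
  by rewrite distrC; exact: segment_norm_lt.
rewrite opprD addrACA mulrDr (le_trans (ler_normD _ _))//.
rewrite -!dotBr (le_trans (lerD (dot_le _ _) (dot_le _ _)))//=.
apply: lerD.
- by rewrite distrC in gs1'; exact: (aux _ _ _ _ _ gs1' en).
- by rewrite distrC in gs2'; exact: (aux _ _ _ _ _ gs2' em).
Qed.

End product.

End gradients.

(** Arithmetic for [approx_gradient]: [p] is the increment of [f] over [t d], and [a = |d|]; [G],
    [B], [g] pair [d] with the gradient of [f], its limit and the first partial gradient; the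
    increment of [y] has size [D] and pairing [S] with the second partial gradient. *)
Lemma gradient_increment {R : realType} (k L e e1 t a D p G B g S : R) :
  0 <= e1 -> 0 < t -> `|p - t * G| <= e1 * (t * a) ->
  `|p - (t * g + S)| <= e1 * (t * a + D) -> D <= L * (t * a) ->
  `|G - B| <= k * a * e1 -> (k + 2 + L) * a * e1 < e ->
  t * (B - e - g) < S.
Proof.
move=> e10 t0; rewrite !ler_norml => /andP[F1 _] /andP[_ F2] DL /andP[F3 _] ke.
have h1 : e1 * D <= e1 * (L * (t * a)) by rewrite ler_wpM2l.
have h2 : t * - (k * a * e1) <= t * (G - B) by rewrite ler_wpM2l// ltW.
have h3 : t * ((k + 2 + L) * a * e1) < t * e by rewrite ltr_pM2l.
lra.
Qed.

(** * Local Lipschitz bounds, and approximation of limit gradients through Jacobians of [y] *)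

Section clarke.
Context {R : realType} {n m : nat}.

Lemma norm_le_enorm k (v : 'rV[R]_k) : `|v| <= enorm v.
Proof.
apply: norm_le_coord => [|i j]; first exact: sqrtr_ge0.
rewrite ord1 -sqrtr_sqr ler_wsqrtr// (bigD1 j)//= lerDl.
by apply: sumr_ge0 => l _; exact: sqr_ge0.
Qed.

Lemma enorm_le_norm k (v : 'rV[R]_k) : enorm v <= k%:R * `|v|.
Proof.
rewrite -[leRHS]ger0_norm ?mulr_ge0// -sqrtr_sqr ler_wsqrtr//.
apply: (@le_trans _ _ (\sum_(i < k) `|v| ^+ 2)).
  apply: ler_sum => i _; rewrite -[v _ _ ^+ 2]real_normK ?num_real//.
  by rewrite lerXn2r ?nnegrE ?coord_le_norm.
rewrite sumr_const card_ord exprMn -[leLHS]mulr_natl ler_wpM2r ?sqr_ge0//.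
by rewrite -natrX ler_nat; case: k {v} => // k; rewrite expnS expn1 leq_pmulr.
Qed.

Lemma locally_lipschitz_ball (N : set 'rV[R]_n) (y : 'rV[R]_n -> 'rV[R]_m) x :
  open N -> locally_lipschitz_on N y -> N x ->
  exists r L, [/\ 0 < r, 0 < L, forall v, `|v - x| <= r -> N v &
    forall v w, `|v - x| <= r -> `|w - x| <= r -> `|y v - y w| <= L * `|v - w|].
Proof.
move=> oN yL Nx; have [L0 [U xU UL]] := yL x Nx.
have /nbhs_ballP[r /= r0 rNU] : nbhs x (N `&` U).
  by apply: filterI => //; exact: open_nbhs_nbhs.
have rr v : `|v - x| <= r / 2 -> N v /\ U v.
  move=> vx; apply: rNU; rewrite -ball_normE /= distrC (le_lt_trans vx)//.
  by rewrite ltr_pdivrMr// ltr_pMr// ltr1n.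
(* Half the radius makes a closed ball fit; [n] compares the two norms, and the absolute value and
   the summand 1 make the constant positive. *)
exists (r / 2), (`|L0| * n%:R + 1); split.
- by rewrite divr_gt0.
- by rewrite ltr_wpDl// mulr_ge0.
- by move=> v /rr[].
move=> v w /rr[_ Uv] /rr[_ Uw].
rewrite (le_trans (norm_le_enorm _))// (le_trans (UL _ _ Uv Uw))//.
rewrite (le_trans (ler_wpM2r (sqrtr_ge0 _) (ler_norm L0)))//.
rewrite (le_trans (ler_wpM2l _ (enorm_le_norm _)))// mulrDl mul1r mulrA.
by rewrite lerDl.
Qed.

Variables (y : 'rV[R]_n -> 'rV[R]_m) (x : 'rV[R]_n) (r L : R).
Hypothesis r_gt0 : 0 < r.
Hypothesis L_gt0 : 0 < L.
Hypothesis yL : forall v w, `|v - x| <= r -> `|w - x| <= r ->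
  `|y v - y w| <= L * `|v - w|.

(** The increments of [y] contribute [L], and the tolerance 1 in the definition of the differential
    contributes the other summand; only boundedness matters later. *)
Lemma jac_le v : `|v - x| < r -> differentiable y v -> `|jac y v| <= L + 1.
Proof.
move=> vr dy.
have L1 : 0 <= L + 1 by rewrite addr_ge0// ltW.
apply: norm_le_coord => // j i.
set d := delta_mx ord0 i : 'rV[R]_n.
have d1 : `|d| <= 1.
  apply: norm_le_coord => // a b; rewrite mxE ger0_norm//.
  by case: (_ && _) => //=; rewrite lexx.
have -> : jac y v j i = 'd y v d ord0 j.
  have -> : 'd y v d = d *m 'J y v by rewrite /jacobian mul_rV_lin1.
  by rewrite -rowE [LHS]mxE [RHS]mxE.
rewrite (le_trans (coord_le_norm _ _ _))//.
have : \forall h \near (0 : 'rV[R]_n), `|v + h - x| < r /\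
    `|y (v + h) - y v - 'd y v h| <= 1 * `|h|.
  have h1 := (nbhs0P (fun w => `|w - x| < r) v).1 (near_norm_lt vr).
  have h2 := differentiable_eps dy ltr01.
  exact: filterI.
move=> /nbhs_norm0P[e /= e0 He].
have t0 : 0 < e / 2 by rewrite divr_gt0.
have hd : `|(e / 2) *: d| <= e / 2 by rewrite normrZ gtr0_norm// ler_piMr// ltW.
have [|] := He ((e / 2) *: d).
  by rewrite /= (le_lt_trans hd)// ltr_pdivrMr// ltr_pMr// ltr1n.
move=> hr hdy; rewrite -(ler_pM2l t0).
rewrite -[X in X * `|_| <= _](gtr0_norm t0) -normrZ -linearZ.
rewrite -[X in `|X|](subKr (y (v + (e / 2) *: d) - y v)).
rewrite (le_trans (ler_normB _ _))// (le_trans (lerD (yL (ltW hr) (ltW vr)) hdy))//.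
by rewrite addrAC addrN add0r -mulrDl mulrC ler_wpM2r.
Qed.

Variable phi : 'rV[R]_n * 'rV[R]_m -> R.
Hypothesis phi_C1 : C1 phi.

Let f u := phi (u, y u).
Let g1 := grad1 phi x (y x).
Let g2 := grad2 phi x (y x).

(** At a point [u] where [f] has a gradient near [b], strict differentiability of [phi] turns the
    increment of [f] along [d] into that of [<y, g2>]; [lipschitz_mvt] then finds [v] where [y]
    itself is differentiable. *)
Lemma approx_gradient b d e : 0 < e ->
  (forall rho, 0 < rho -> exists u, [/\ `|u - x| < rho, differentiable f u &
     `|grad f u - b| < rho]) ->
  exists v, [/\ `|v - x| < e, `|v - x| < r, differentiable y v &
    dot d b - e <= dot d (g1 + g2 *m jac y v)].
Proof.
move=> e0 grads.
pose D := (n%:R + 2 + L) * (`|d| + 1).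
have nL : 0 < n%:R + 2 + L by rewrite ltr_wpDl// addr_ge0.
have D0 : 0 < D by rewrite mulr_gt0// ltr_wpDl.
pose e1 := e / D.
have e10 : 0 < e1 by rewrite divr_gt0.
have e1D : (n%:R + 2 + L) * `|d| * e1 < e.
  by rewrite /e1 mulrCA gtr_pMr// ltr_pdivrMr// mul1r /D ltr_pM2l// ltrDl.
have [del del0 strict] := C1_strict_diff x (y x) phi_C1 e10.
(* The bounds keep points in the Lipschitz ball, [v] within [e] of [x], both arguments of [phi]
   within [del], and the gradient within [e1] of [b]. *)
pose rho := Num.min (Num.min r e) (Num.min (Num.min del (del / L)) e1).
have rho0 : 0 < rho by rewrite !lt_min r_gt0 e0 del0 e10 divr_gt0.
have [rho_r rho_e rho_del rho_dL rho_e1] :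
    [/\ rho <= r, rho <= e, rho <= del, rho <= del / L & rho <= e1].
  by split; rewrite /rho !ge_min lexx ?orbT.
have ydel v : `|v - x| < rho -> `|y v - y x| < del.
  move=> vx; rewrite (le_lt_trans (yL _ _))//.
  - by rewrite (le_trans _ rho_r)// ltW.
  - by rewrite subrr normr0 ltW.
  - by rewrite mulrC -ltr_pdivlMr// (lt_le_trans vx).
have [u [ux df gb]] := grads _ rho0.
have : \forall h \near (0 : 'rV[R]_n), `|u + h - x| < rho /\
    `|f (u + h) - f u - 'd f u h| <= e1 * `|h|.
  have h1 := (nbhs0P (fun w => `|w - x| < rho) u).1 (near_norm_lt ux).
  have h2 := differentiable_eps df e10.
  exact: filterI.
move=> /nbhs_norm0P[e2 /= e20 He].
have d10 : 0 < `|d| + 1 by rewrite ltr_wpDl.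
pose t := e2 / (`|d| + 1).
have t0 : 0 < t by rewrite divr_gt0.
have td : `|t *: d| = t * `|d| by rewrite normrZ gtr0_norm.
have [|utx F1] := He (t *: d).
  by rewrite /= td /t mulrAC ltr_pdivrMr// ltr_pM2l// ltrDl.
have utE : u + t *: d - u = t *: d by rewrite addrAC addrN add0r.
have F2 := strict u (u + t *: d) (y u) (y (u + t *: d)).
have {}F2 := F2 (lt_le_trans ux rho_del) (lt_le_trans utx rho_del) (ydel _ ux) (ydel _ utx).
have F3 : `|dot d (grad f u - b)| <= n%:R * `|d| * e1.
  by rewrite (le_trans (dot_le _ _))// ler_wpM2l ?mulr_ge0// (le_trans (ltW gb)).
have yle : `|y (u + t *: d) - y u| <= L * (t * `|d|).
  rewrite (le_trans (yL _ _)) ?(le_trans (ltW utx))// ?(le_trans (ltW ux))//.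
  by rewrite utE td.
rewrite utE td dotZl -/g1 -/g2 in F2.
rewrite linearZ/= diff_grad td in F1.
set Dy := y (u + t *: d) - y u in F2 yle.
have key : t * (dot d b - e - dot d g1) < dot Dy g2.
  by apply: gradient_increment F1 F2 yle _ e1D; [exact: ltW| |rewrite -dotBr].
have yrho v w : `|v - x| <= rho -> `|w - x| <= rho -> `|y v - y w| <= L * `|v - w|.
  by move=> vx wx; apply: yL; [exact: le_trans vx _|exact: le_trans wx _].
have [v [vx dv av]] := lipschitz_mvt (c := g2^T) rho0 L_gt0 yrho ux utx key.
exists v; split => //; [exact: lt_le_trans vx _|exact: lt_le_trans vx _|].
move: av; rewrite -/(dot _ _) dot_diff_jac dotZl ler_pM2l// => av.
by rewrite dotDr; lra.
Qed.

End clarke.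

(** * Limits of sequences in epsilon form, and tools for compactness *)

Section limit_points.
Context {R : realType}.

(** The sequence is rebuilt by choosing a point for each tolerance [1/(k+1)]. Closedness is easier
    to check in the epsilon form. *)
Lemma limit_pointP {V W : normedModType R} (P : V -> Prop) (G : V -> W) x w :
  (exists u : nat -> V, [/\ forall k, P (u k), u @ \oo --> x &
     (fun k => G (u k)) @ \oo --> w]) <->
  forall e, 0 < e -> exists u, [/\ P u, `|u - x| < e & `|G u - w| < e].
Proof.
split=> [[u [Pu ux Gw]] e e0|approx].
  have h1 : \forall k \near \oo, `|x - u k| < e by move/cvgrPdist_lt : ux; exact.
  have h2 : \forall k \near \oo, `|w - G (u k)| < e by move/cvgrPdist_lt : Gw; exact.
  have /filter_ex[k [k1 k2]] : \forall k \near \oo, `|x - u k| < e /\ `|w - G (u k)| < e.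
    exact: filterI.
  by exists (u k); rewrite (distrC _ x) (distrC _ w).
have seqE (k : nat) : {v | [/\ P v, `|v - x| < k.+1%:R^-1 & `|G v - w| < k.+1%:R^-1]}.
  by apply: cid; apply: approx; rewrite invr_gt0.
have small (e : R) : 0 < e -> \forall k \near \oo, (k.+1%:R^-1 : R) < e.
  by move=> e0; exact: (near_infty_natSinv_lt (PosNum e0)).
exists (fun k => projT1 (seqE k)); split.
- by move=> k; case: (seqE k) => v [].
- apply/cvgrPdist_lt => e e0; apply: filterS (small e e0) => k ke.
  by case: (seqE k) => v [_ vx _] /=; rewrite distrC (lt_trans vx).
- apply/cvgrPdist_lt => e e0; apply: filterS (small e e0) => k ke.
  by case: (seqE k) => v [_ _ vw] /=; rewrite distrC (lt_trans vw).
Qed.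

Lemma cvg_mulmx n m (a : nat -> 'rV[R]_m) (B : nat -> 'M[R]_(m, n))
    (a0 : 'rV[R]_m) (B0 : 'M[R]_(m, n)) :
  a @ \oo --> a0 -> B @ \oo --> B0 -> (fun k => a k *m B k) @ \oo --> a0 *m B0.
Proof.
move=> aa BB; apply/subr_cvg0/norm_cvg0P.
have h1 : (fun k => `|a k - a0|) @ \oo --> (0 : R).
  by apply/norm_cvg0P/subr_cvg0.
have h2 : (fun k => `|B k - B0|) @ \oo --> (0 : R).
  by apply/norm_cvg0P/subr_cvg0.
have h3 := cvg_norm BB.
have h : (fun k => m%:R * `|a k - a0| * `|B k| + m%:R * `|a0| * `|B k - B0|) @ \oo -->
    (m%:R * 0 * `|B0| + m%:R * `|a0| * 0 : R).
  apply: (@cvgD R R^o nat \oo); last by apply: (@cvgM R nat \oo) => //; exact: cvg_cst.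
  apply: (@cvgM R nat \oo); last exact: h3.
  by apply: (@cvgM R nat \oo) => //; exact: cvg_cst.
have z : m%:R * 0 * `|B0| + m%:R * `|a0| * 0 = 0 :> R.
  by rewrite !mulr0 mul0r addr0.
rewrite z in h.
apply: (squeeze_cvgr _ (cvg_cst 0) h); apply: nearW => k.
rewrite normr_ge0/=.
have -> : a k *m B k - a0 *m B0 = (a k - a0) *m B k + a0 *m (B k - B0).
  by rewrite mulmxBl mulmxBr addrA subrK.
by rewrite (le_trans (ler_normD _ _))// lerD// norm_mulmx_le.
Qed.

(** Compactness is argued on rows; with [norm_vec_mx] this makes the flattening of matrices an
    isometry. *)
Lemma norm_mxvec n m (A : 'M[R]_(m, n)) : `|mxvec A| <= `|A|.
Proof.
by apply: norm_le_coord => // i j; rewrite ord1; case/mxvec_indexP: j => k l;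
  rewrite mxvecE coord_le_norm.
Qed.

Lemma norm_vec_mx n m (v : 'rV[R]_(m * n)) : `|vec_mx v : 'M[R]_(m, n)| <= `|v|.
Proof. by apply: norm_le_coord => // i j; rewrite mxE coord_le_norm. Qed.

Lemma compact_closed_norm_ball k (M : R) : compact [set v : 'rV[R]_k | `|v| <= M].
Proof.
apply: bounded_closed_compact.
  exists M; split; first exact: num_real.
  by move=> M' MM' v /= vM; rewrite (le_trans vM)// ltW.
rewrite (_ : [set _ | _] = (fun v : 'rV[R]_k => `|v|) @^-1` [set z | z <= M])//.
by apply: preimage_closed; [move=> v _; exact: norm_continuous|exact: closed_le].
Qed.

End limit_points.

(** * The Clarke chain rule at a point *)

Section clarke_chain.
Context {R : realType} {n m : nat}.
Variables (y : 'rV[R]_n -> 'rV[R]_m) (x : 'rV[R]_n) (r L : R).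
Variables (N : set 'rV[R]_n) (phi : 'rV[R]_n * 'rV[R]_m -> R).
Hypothesis r_gt0 : 0 < r.
Hypothesis L_gt0 : 0 < L.
Hypothesis yL : forall v w, `|v - x| <= r -> `|w - x| <= r ->
  `|y v - y w| <= L * `|v - w|.
Hypothesis N_ball : forall v, `|v - x| <= r -> N v.
Hypothesis phi_C1 : C1 phi.

Let g1 := grad1 phi x (y x).
Let g2 := grad2 phi x (y x).
Let f u := phi (u, y u).

Let limit_jacobians : set 'M[R]_(m, n) :=
  [set V | exists u : nat -> 'rV[R]_n,
    [/\ forall k, N (u k) /\ differentiable y (u k), u @ \oo --> x &
        (fun k => jac y (u k)) @ \oo --> V]].

Let limit_gradients : set 'rV[R]_n :=
  [set v | exists u : nat -> 'rV[R]_n,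
    [/\ forall k, N (u k) /\ differentiable f (u k), u @ \oo --> x &
        (fun k => grad f (u k)) @ \oo --> v]].

Let limit_jacobiansP V := @limit_pointP R 'rV[R]_n 'M[R]_(m, n)
  (fun u => N u /\ differentiable y u) (jac y) x V.

Let chain (V : 'M[R]_(m, n)) : 'rV[R]_n := g1 + g2 *m V.

(** The smooth chain rule holds along the sequence, and its coefficients converge since [phi] is
    [C1] and [y] is continuous at [x]. *)
Lemma limit_gradients_chain V : limit_jacobians V -> limit_gradients (chain V).
Proof.
move=> [u [Nu ux jV]]; have [dphi c1 c2] := phi_C1.
exists u; split => //.
  by move=> k; split; [exact: (Nu k).1|exact: (grad_comp (dphi _) (Nu k).2).1].
have -> : (fun k => grad f (u k)) =
    (fun k => grad1 phi (u k) (y (u k)) + grad2 phi (u k) (y (u k)) *m jac y (u k)).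
  by apply/funext => k; exact: (grad_comp (dphi _) (Nu k).2).2.
have yux : (fun k => y (u k)) @ \oo --> y x.
  apply/cvgrPdist_lt => e e0.
  have d0 : 0 < Num.min r (e / L) by rewrite lt_min r_gt0 divr_gt0.
  have : \forall k \near \oo, `|x - u k| < Num.min r (e / L).
    by move/cvgrPdist_lt : ux; exact.
  apply: filterS => k; rewrite lt_min => /andP[ur ue].
  rewrite (le_lt_trans (yL _ _)) ?subrr ?normr0 ?(ltW r_gt0)//.
    by rewrite distrC ltW.
  by rewrite mulrC -ltr_pdivlMr.
pose z0 : 'rV[R]_n * 'rV[R]_m := (x, y x).
have pux : (fun k => (u k, y (u k))) @ \oo --> z0 by exact: (cvg_pair ux yux).
have k1 : (fun k => grad1 phi (u k) (y (u k))) @ \oo --> g1.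
  exact: (@cvg_comp _ _ _ _ (fun z => grad1 phi z.1 z.2) _ _ _ pux (c1 z0)).
have k2 : (fun k => grad2 phi (u k) (y (u k))) @ \oo --> g2.
  exact: (@cvg_comp _ _ _ _ (fun z => grad2 phi z.1 z.2) _ _ _ pux (c2 z0)).
exact: (cvgD k1 (cvg_mulmx k2 jV)).
Qed.

Lemma limit_jacobians_le V : limit_jacobians V -> `|V| <= L + 1.
Proof.
move/limit_jacobiansP => HV; apply/ler_addgt0Pr => e e0.
have [|u [[_ dy] ux uV]] := HV (Num.min r e); first by rewrite lt_min r_gt0.
rewrite -[V](subKr (jac y u)) (le_trans (ler_normB _ _))//.
move: ux uV; rewrite !lt_min => /andP[ur _] /andP[_ ue].
by apply: lerD; [exact: (jac_le L_gt0 yL ur dy)|exact: ltW].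
Qed.

(** For closedness, half the tolerance goes to a nearby limit Jacobian and half to a Jacobian
    approximating that one. *)
Lemma compact_limit_jacobians :
  compact [set v : 'rV[R]_(m * n) | limit_jacobians (vec_mx v)].
Proof.
apply: bounded_closed_compact.
  exists (L + 1); split; first exact: num_real.
  move=> M LM v /= /limit_jacobians_le vL.
  by rewrite -[v]vec_mxK (le_trans (norm_mxvec _))// (le_trans vL)// ltW.
move=> v vcl; apply/limit_jacobiansP => e e0.
have e20 : 0 < e / 2 by rewrite divr_gt0.
have [w [/limit_jacobiansP/(_ _ e20)[u [Pu ux uw]]]] := vcl _ (nbhsx_ballx v _ e20).
rewrite -ball_normE /= distrC => wv.
exists u; split => //; first by rewrite (lt_trans ux)// ltr_pdivrMr// ltr_pMr// ltr1n.
rewrite -(subrK (vec_mx w) (jac y u)) -addrA (splitr e) -linearB.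
rewrite (le_lt_trans (ler_normD _ _))// ltrD//.
by rewrite (le_lt_trans (norm_vec_mx _)).
Qed.

Lemma chain_vec_mx_continuous :
  continuous (fun v : 'rV[R]_(m * n) => chain (vec_mx v)).
Proof.
apply: (@lipschitz_continuous _ _ _ _ (m%:R * `|g2| + 1)).
  by rewrite ltr_wpDl// mulr_ge0.
move=> u v; rewrite /chain opprD addrACA addrN add0r -mulmxBr -linearB.
rewrite (le_trans (norm_mulmx_le _ _))// mulrDl mul1r.
by rewrite (le_trans (ler_wpM2l _ (norm_vec_mx _))) ?mulr_ge0// lerDl.
Qed.

(** Tolerances [1/(k+1)] in [approx_gradient] give bounded Jacobians; a cluster point of these is
    the required [V], and the inequality survives by continuity of [chain]. *)
Lemma limit_gradient_support b d : limit_gradients b ->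
  exists2 V, limit_jacobians V & dot b d <= dot (chain V) d.
Proof.
move=> /(@limit_pointP R 'rV[R]_n 'rV[R]_n
  (fun u => N u /\ differentiable f u) (grad f) x b).1 grads.
have vE (k : nat) : {v | [/\ `|v - x| < k.+1%:R^-1, `|v - x| < r, differentiable y v &
    dot d b - k.+1%:R^-1 <= dot d (g1 + g2 *m jac y v)]}.
  apply: cid; apply: (approx_gradient r_gt0 L_gt0 yL phi_C1).
    by rewrite invr_gt0.
  by move=> rho /grads[u [[_ du] ux ub]]; exists u.
pose v k := projT1 (vE k); pose s k := mxvec (jac y (v k)).
have sC : \forall k \near \oo, [set w : 'rV[R]_(m * n) | `|w| <= L + 1] (s k).
  apply: nearW => k /=; rewrite /s /v; case: (vE k) => w [_ wr dw _] /=.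
  by rewrite (le_trans (norm_mxvec _))//; exact: (jac_le L_gt0 yL).
have [w [_ wcl]] := @compact_closed_norm_ball R (m * n) (L + 1) (s @ \oo) _ sC.
(* A neighbourhood of the cluster point is visited at arbitrarily late indices, hence with
   arbitrarily small tolerance. *)
have near_w U (e : R) : nbhs w U -> 0 < e -> exists k, U (s k) /\ k.+1%:R^-1 < e.
  move=> wU e0.
  have hs : \forall k \near \oo, [set z | exists k, s k = z /\ k.+1%:R^-1 < e] (s k).
    have h : \forall k \near \oo, (k.+1%:R^-1 : R) < e.
      exact: (near_infty_natSinv_lt (PosNum e0)).
    by apply: filterS h => k ke; exists k.
  by have [_ [[k [<- ke]] Usk]] := wcl _ _ hs wU; exists k.
exists (vec_mx w).
  apply/limit_jacobiansP => e e0.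
  have [k []] := near_w _ e (nbhsx_ballx w _ e0) e0.
  rewrite -ball_normE /= /s /v; case: (vE k) => u [ux ur du _] /= wu ke.
  exists u; split; first by split => //; apply: N_ball; exact: ltW.
    exact: lt_trans ke.
  rewrite -(mxvecK (jac y u)) -linearB (le_lt_trans (norm_vec_mx _))//.
  by rewrite distrC.
rewrite !(dotC _ d); apply/ler_addgt0Pr => e e0.
have e20 : 0 < e / 2 by rewrite divr_gt0.
have wnear : \forall z \near w, `|dot d (chain (vec_mx w)) - dot d (chain (vec_mx z))| < e / 2.
  have c : {for w, continuous (fun z => dot d (chain (vec_mx z)))}.
    apply: (@continuous_comp _ _ _ (fun z => chain (vec_mx z)) (dot d)).
      exact: chain_vec_mx_continuous.
    exact: dot_continuous.
  by move/cvgrPdist_lt : c; exact.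
have [k [wk ke]] := near_w _ _ wnear e20.
move: wk; rewrite /= /s /v; case: (vE k) => u [_ _ _ ub] /=.
rewrite mxvecK => wk; move: (ler_norm (dot d (chain (jac y u)) - dot d (chain (vec_mx w)))).
rewrite distrC => h.
have {}ub : dot d b - k.+1%:R^-1 <= dot d (chain (jac y u)) by [].
move: (k.+1%:R^-1 : R) ke ub => q ke ub; lra.
Qed.

Lemma convex_chain_image (A : set 'M[R]_(m, n)) : @convex_set R 'M[R]_(m, n) A ->
  @convex_set R 'rV[R]_n (chain @` A).
Proof.
move=> /convex_setE cA; apply/convex_setE => _ _ t [V AV <-] [W AW <-] t0 t1.
exists (t *: V + (1 - t) *: W); first exact: cA.
rewrite /chain mulmxDr -!scalemxAr !scalerDr addrACA -scalerDl.
by rewrite (addrC t) subrK scale1r.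
Qed.

Lemma clarke_chain_rule : convex_hull limit_gradients =
  chain @` convex_hull limit_jacobians.
Proof.
apply/seteqP; split.
  apply: convex_hull_sub.
    by apply: convex_chain_image; exact: convex_hull_convex.
  move=> b bG.
  pose K := chain @` limit_jacobians.
  have Kimg : K = (fun v => chain (vec_mx v)) @`
      [set v : 'rV[R]_(m * n) | limit_jacobians (vec_mx v)].
    apply/seteqP; split=> [_ [V JV <-]|_ [v Jv <-]]; last by exists (vec_mx v).
    by exists (mxvec V) => /=; rewrite mxvecK.
  have cK : compact K.
    rewrite Kimg; apply: continuous_compact compact_limit_jacobians.
    by apply: continuous_subspaceT; exact: chain_vec_mx_continuous.
  have : convex_hull K b.
    apply: convex_compact_separation.
    - exact: convex_hull_compact.
    - exact: convex_hull_convex.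
    - move=> d; have [V JV bV] := limit_gradient_support d bG.
      by exists (chain V) => //; apply: sub_convex_hull; exists V.
  apply: convex_hull_sub; first by apply: convex_chain_image; exact: convex_hull_convex.
  by move=> _ [V JV <-]; exists V => //; exact: sub_convex_hull.
move=> _ [V JV <-].
(* The preimage of the hull under the affine map [chain] is convex and contains the limit Jacobians,
   hence their hull. *)
pose C := [set U | convex_hull limit_gradients (chain U)].
apply: (@convex_hull_sub _ 'M[R]_(m, n) limit_jacobians C) JV.
  apply/convex_setE => U W t CU CW t0 t1; rewrite /C /=.
  have -> : chain (t *: U + (1 - t) *: W) = t *: chain U + (1 - t) *: chain W.
    rewrite /chain mulmxDr -!scalemxAr !scalerDr addrACA -scalerDl.
    by rewrite (addrC t) subrK scale1r.
  have /convex_setE := @convex_hull_convex R _ limit_gradients; exact.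
by move=> U JU; apply: sub_convex_hull; exact: limit_gradients_chain.
Qed.

End clarke_chain.

Theorem proposition1 (R : realType) (n m : nat)
    (X N : set 'rV[R]_n) (Y : set 'rV[R]_m)
    (g : 'rV[R]_n -> 'rV[R]_m -> R) (y : 'rV[R]_n -> 'rV[R]_m)
    (deltabar Ymax Ly : R)
    (phi : 'rV[R]_n * 'rV[R]_m -> R)
    (W : set ('rV[R]_n * 'rV[R]_m))
    (L1x L1y L2x L2y My : R)
    (Xdelta := [set x + deltabar *: b | x in X & b in unit_ball])
    (X_nonempty : X !=set0)
    (X_compact : compact X)
    (N_open : open N)
    (X_sub_N : X `<=` N)
    (y_argmin : forall x, N x -> argmin Y (g x) = [set y x])
    (y_loclip : locally_lipschitz_on N y)
    (deltabar_gt0 : 0 < deltabar)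
    (Xdelta_sub_N : Xdelta `<=` N)
    (y_bounded : forall x : 'rV[R]_n, Xdelta x -> enorm (y x) <= Ymax)
    (y_lipschitz : forall x x' : 'rV[R]_n, Xdelta x -> Xdelta x' ->
      enorm (y x - y x') <= Ly * enorm (x - x'))
    (phi_C1 : C1 phi)
    (consts_gt0 : [/\ 0 < L1x, 0 < L1y, 0 < L2x, 0 < L2y & 0 < My])
    (W_y : forall x, X x -> W (x, y x))
    (W_smoothed : forall (x : 'rV[R]_n) (delta : R), X x -> 0 < delta -> delta <= deltabar ->
      W (x, smoothed y delta x))
    (grad1_lipschitz : forall z z', W z -> W z' ->
      enorm (grad1 phi z.1 z.2 - grad1 phi z'.1 z'.2) <=
        L1x * enorm (z.1 - z'.1) + L1y * enorm (z.2 - z'.2))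
    (grad2_lipschitz : forall z z', W z -> W z' ->
      enorm (grad2 phi z.1 z.2 - grad2 phi z'.1 z'.2) <=
        L2x * enorm (z.1 - z'.1) + L2y * enorm (z.2 - z'.2))
    (grad2_bounded : forall z, W z -> enorm (grad2 phi z.1 z.2) <= My)
    (dx := fun x => grad1 phi x (y x))
    (dy := fun x => grad2 phi x (y x)) :
  forall x, X x ->
    clarke_subdifferential N (fun u => phi (u, y u)) x =
    [set dx x + dy x *m V | V in clarke_jacobian N y x].
Proof.
move=> x Xx.
(* A sup-norm ball inside [N] on which [y] is Lipschitz reduces the claim to the chain rule at
   [x]. *)
have [r [L [r0 L0 xN yL]]] := locally_lipschitz_ball N_open y_loclip (X_sub_N _ Xx).
exact: (clarke_chain_rule r0 L0 yL xN phi_C1).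
Qed.
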